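(* Let $G^{\varphi}$ be a connected complex unit gain graph with underlying graph $G$. Then $p(G^{\varphi})=m(G)+c(G)$ if and only if the following three conditions all hold: (a) any two (distinct) cycles of $G^{\varphi}$ share no common vertices; (b) each cycle of $G^{\varphi}$ is of Type C; (c) $m(T_{G})=m(G-O(G))$.
   Context: All graphs are finite and simple (no loops or multiple edges). A complex unit gain graph $G^{\varphi}$ consists of a graph $G$ (the underlying graph) with vertices $v_1,\dots,v_n$ and a function $\varphi$ assigning to each oriented edge $e_{ij}$ (from $v_i$ to $v_j$, where $v_iv_j\in E(G)$; both orientations of each edge are considered) a number $\varphi(e_{ij})=\varphi_{v_iv_j}\in\mathbb{T}=\{z\in\mathbb{C}:|z|=1\}$ such that $\varphi(e_{ij})=\varphi(e_{ji})^{-1}=\overline{\varphi(e_{ji})}$. Its adjacency matrix $A(G^{\varphi})$ is the $n\times n$ Hermitian matrix with $(i,j)$ entry $\varphi(e_{ij})$ if $v_iv_j\in E(G)$ and $0$ otherwise. $p(G^{\varphi})$ denotes the number of positive eigenvalues of $A(G^{\varphi})$, counted with multiplicity. $m(G)$ is the matching number of $G$ (with $m=0$ for a graph without vertices). $c(G)=|E(G)|-|V(G)|+\omega(G)$ is the cyclomatic number, where $\omega(G)$ is the number of connected components of $G$. Cycles of $G^{\varphi}$ are the cycles of $G$ with the restricted gains; $G^{\varphi}$ is connected if $G$ is. For a cycle $C_q$ with consecutive vertices $w_1,w_2,\dots,w_q$, $q\ge 3$, put $\varphi(C_q)=\varphi_{w_1w_2}\varphi_{w_2w_3}\cdots\varphi_{w_{q-1}w_q}\varphi_{w_qw_1}$.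 The cycle is of Type C if $q$ is odd and $\mathrm{Re}\left((-1)^{(q-1)/2}\varphi(C_q)\right)>0$, where $\mathrm{Re}$ is the real part (this does not depend on the starting vertex or direction). $O(G)$ is the set of vertices lying on cycles of $G$, and $G-O(G)$ is the induced subgraph obtained by deleting these vertices. When the cycles of $G$ are pairwise vertex-disjoint, $T_G$ is the acyclic graph obtained from $G$ by contracting each cycle of $G$ to a single vertex (so $T_G=G$ if $G$ has no cycles); condition (c) is understood together with condition (a), under which $T_G$ is defined. *)

(* Defs.v *)
From mathcomp Require Import all_boot all_order all_algebra.
From mathcomp Require Export complex reals.

Set Implicit Arguments.
Unset Strict Implicit.
Unset Printing Implicit Defensive.

Import Order.TTheory GRing.Theory Num.Theory.

Local Open Scope ring_scope.

(* A simple graph on a finite vertex type V is a symmetric irreflexive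
   relation e : rel V. *)
Section Graph.

Variables (V : finType) (e : rel V).

Definition simple_graph : Prop := symmetric e /\ irreflexive e.

Definition connected_graph : Prop := forall x y : V, connect e x y.

Definition edges : {set {set V}} := [set [set x; y] | x in V, y in V & e x y].

Definition matching (M : {set {set V}}) : bool := (M \subset edges) && trivIset M.

Definition matching_number : nat := (\max_(M : {set {set V}} | matching M) #|M|)%N.

Definition cyclomatic_number : int :=
  #|edges|%:Z - #|V|%:Z + (n_comp e predT)%:Z.

Definition induced (A : {set V}) : rel {x : V | x \in A} := relpre val e.

(* A cycle is given by its list of consecutive vertices, so a cycle with q
   vertices has 2q such descriptions. Two lists describe the same subgraph
   exactly when their edge sets agree; the vertex sets alone do not suffice
   (K_4 has three Hamiltonian cycles). *)
Definition is_cycle (s : seq V) : bool := (3 <= size s)%N && ucycleb e s.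

Definition cycle_edges (s : seq V) : {set {set V}} :=
  [set [set x; next s x] | x in s].

Definition disjoint_cycles : Prop :=
  forall s t : seq V, is_cycle s -> is_cycle t ->
    cycle_edges s != cycle_edges t -> [disjoint s & t].

(* The vertex sets of the cycles. *)
Definition cycle_supports : {set {set V}} :=
  [set A : {set V} |
    [exists s : #|A|.-tuple V, is_cycle s && ([set x in s] == A)]].

Definition cycle_vertices : {set V} := cover cycle_supports.

(* Contraction of every cycle to a point, for a graph with pairwise disjoint
   cycles (no meaning is intended otherwise): the vertices are the vertex sets
   of the cycles and the singletons of the vertices lying on no cycle. *)
Definition contraction_vertices : {set {set V}} :=
  cycle_supports :|: [set [set x] | x in ~: cycle_vertices].

Definition contraction : rel {B : {set V} | B \in contraction_vertices} :=
  fun B1 B2 =>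
    (B1 != B2) && [exists x in val B1, exists y in val B2, e x y].

End Graph.

Section Gain.

Variables (C : numClosedFieldType) (n : nat) (e : rel 'I_n).
Variable (phi : 'I_n -> 'I_n -> C).

(* The values of phi off the edges are irrelevant. *)
Definition unit_gain : Prop :=
  forall i j, e i j -> `|phi i j| = 1 /\ phi i j = (phi j i)^-1.

Definition gain_adjacency : 'M[C]_n :=
  \matrix_(i, j) (if e i j then phi i j else 0).

Definition cycle_gain (s : seq 'I_n) : C := \prod_(x <- s) phi x (next s x).

Definition typeC (s : seq 'I_n) : Prop :=
  odd (size s) /\ 0 < 'Re ((-1) ^+ ((size s).-1)./2 * cycle_gain s).

End Gain.

(* The eigenvalues, listed with multiplicity as the roots of the
   characteristic polynomial. *)
Definition eigenvalues (C : numClosedFieldType) (n : nat) (A : 'M[C]_n) : seq C :=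
  sval (closed_field_poly_normal (char_poly A)).

(* In a numClosedFieldType, 0 < z says that z is real and positive. *)
Definition positive_inertia (C : numClosedFieldType) (n : nat) (A : 'M[C]_n) : nat :=
  count (fun z => 0 < z) (eigenvalues A).

(* Main.v *)
(* Deleting a vertex of a cycle lowers p by at most 1 and the cyclomatic number
   c by at least 1, and deleting the neighbour of a leaf lowers p by at most 1
   and m by at least 1, so p <= m + c always. In case of equality, deleting a
   vertex x of a cycle keeps m and lowers c by exactly 1; two cycles with a
   common vertex would allow a drop of 2, whence (a). If xz is a bridge and x
   lies on a cycle, then z is essential for maximum matchings, and equality
   survives the deletion of z. Deleting the set Z of all these z isolates every
   cycle, which reduces (b) to the inertia of a single cycle. For (c), a maximum
   matching missing one vertex of each cycle matches the rest of each cycle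
   within itself, so it matches |Z| + m(G - O(G) - Z) edges outside O(G), and
   this number bounds m(T_G).

   Conversely, under (a) and (c), a minimum vertex cover U of the forest T_G
   (Koenig) consists of vertices outside O(G), covers all bridges of G and is
   matched into an independent set W outside O(G). The coordinate vectors of W
   together with a positive subspace for the union of the cycles span a space
   on which the Hermitian form is nonnegative and which meets the kernel
   trivially; hence p >= |U| + p(cycles), and (b) gives equality. *)
Require Import Defs.
From mathcomp Require Import all_boot all_order all_algebra.
From mathcomp Require Import complex reals.
From mathcomp Require Import zify ring.

Set Implicit Arguments.
Unset Strict Implicit.
Unset Printing Implicit Defensive.

Import Order.TTheory GRing.Theory Num.Theory.

(** * Bridges, cycles and matchings *)

(** An edge lies on a cycle exactly when it is not a bridge, and the inductions use this form, since
    lists of vertices are awkward under deletions. Let H be the subgraph of nonbridges and O = O(G).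
    H carries the whole cyclomatic number, and under (a) it consists of disjoint cycles and isolated
    vertices, so |O| <= 2 m(H) + c, because q <= 2 floor(q/2) + 1 for a cycle with q vertices. This
    inequality forces a maximum matching that avoids one vertex per cycle to match the rest of each
    cycle within itself. In the converse the form vanishes on the vectors supported on W, so a
    positive definite space of the right dimension is not at hand; a nonnegative space without
    kernel vectors replaces it. A kernel vector in that space has form 0, hence no part on the
    cycles, hence support in W, where a walk through bridges rules it out. For an odd cycle with q =
    2k+1, the number (-1)^k phi(C) appears when the entries at the even positions are prescribed so
    that all edges but the closing one cancel in the form; this costs k dimensions. *)

Section Graphs.

Variable V : finType.
Implicit Types (e f : rel V) (x y z u v w : V) (A B : {set V}).

Lemma eq_set2 x y u v :
  ([set x; y] == [set u; v]) = (x == u) && (y == v) || (x == v) && (y == u).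
Proof.
apply/eqP/idP => [eq_xy|/orP[] /andP[/eqP xE /eqP yE]]; last first.
- by rewrite xE yE setUC.
- by rewrite xE yE.
have := set21 u v; have := set22 u v; rewrite -eq_xy !inE.
have := set21 x y; have := set22 x y; rewrite eq_xy !inE.
rewrite ![_ == x]eq_sym ![_ == y]eq_sym.
have [<-|xu] := eqVneq x u => /=.
  by case: (y == v) => //=; case: (x == v) => //=; rewrite !orbF => ->.
by case: (x == v) => //=; case: (y == u) => //=; rewrite ?andbT ?andbF ?orbT.
Qed.

(** The vertices of [A] stay in the type as isolated points. This affects neither matchings nor the
    cyclomatic number nor the inertia, so all inductions run over relations on one vertex type and
    matrices of one size. *)
Definition del A e : rel V := fun x y => [&& e x y, x \notin A & y \notin A].
Arguments del A e x y /.

Definition del_edge x y e : rel V :=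
  fun u v => e u v && ([set u; v] != [set x; y]).
Arguments del_edge x y e u v /.

(** In a simple graph these are the edges that lie on a cycle, by [cycle_edge_nonbridge] and
    [nonbridge_cycle]. *)
Definition nonbridge e : rel V :=
  fun x y => e x y && connect (del_edge x y e) x y.
Arguments nonbridge e x y /.

Lemma del_edgeC x y e : del_edge x y e =2 del_edge y x e.
Proof. by move=> u v; rewrite /= (setUC [set x]). Qed.

Lemma simple_del A e : simple_graph e -> simple_graph (del A e).
Proof.
by case=> es ei; split=> [x y|x] /=; rewrite ?ei // es [(x \notin A) && _]andbC.
Qed.

Lemma simple_del_edge x y e : simple_graph e -> simple_graph (del_edge x y e).
Proof.
by case=> es ei; split=> [u v|u] /=; rewrite ?ei // es (setUC [set u]).
Qed.

Lemma simple_connect_sym e : simple_graph e -> connect_sym e.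
Proof. by case=> es _; apply: sym_connect_sym. Qed.

Lemma nonbridge_sym e : simple_graph e -> symmetric (nonbridge e).
Proof.
move=> eG x y; have [es _] := eG; rewrite /= es.
rewrite (simple_connect_sym (simple_del_edge x y eG)).
by rewrite (eq_connect (del_edgeC x y e)).
Qed.

Lemma simple_nonbridge e : simple_graph e -> simple_graph (nonbridge e).
Proof.
by move=> eG; split=> [|x]; [exact: nonbridge_sym | rewrite /= eG.2].
Qed.

Lemma sub_connect e f : subrel e f -> subrel (connect e) (connect f).
Proof. by move=> ef; apply: connect_sub => x y /ef/connect1. Qed.

Lemma sub_del_edge x y e f : subrel e f -> subrel (del_edge x y e) (del_edge x y f).
Proof. by move=> ef u v /= /andP[/ef -> ->]. Qed.

Lemma nonbridge_sub e f : subrel e f -> subrel (nonbridge e) (nonbridge f).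
Proof.
move=> ef x y /= /andP[exy cxy]; rewrite ef //=.
exact: sub_connect (sub_del_edge ef) _ _ cxy.
Qed.

Lemma del_sub A e : subrel (del A e) e.
Proof. by move=> x y /= /andP[]. Qed.

Lemma del_edge_sub x y e : subrel (del_edge x y e) e.
Proof. by move=> u v /= /andP[]. Qed.

Lemma del_subset A B e : A \subset B -> subrel (del B e) (del A e).
Proof.
move=> /subsetP AB x y /= /and3P[-> xB yB] /=.
by rewrite (contra (AB _) xB) (contra (AB _) yB).
Qed.

Lemma mem_edges e x y : symmetric e -> ([set x; y] \in edges e) = e x y.
Proof.
move=> es; apply/imset2P/idP => [[u v _ + /eqP]|exy].
  rewrite inE => euv; rewrite eq_set2 => /orP[] /andP[/eqP -> /eqP ->] //; by rewrite es.
by exists x y; rewrite ?inE.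
Qed.

Lemma edgesP e (E : {set V}) :
  reflect (exists x y, e x y /\ E = [set x; y]) (E \in edges e).
Proof.
apply: (iffP imset2P) => [[u v _ + ->]|[x [y [exy ->]]]].
  by rewrite inE => euv; exists u, v.
by exists x y; rewrite ?inE.
Qed.

Lemma edges_sub e f : subrel e f -> edges e \subset edges f.
Proof.
by move=> ef; apply/subsetP => E /edgesP[x [y [/ef fxy ->]]]; apply/edgesP; exists x, y.
Qed.

Lemma edges_del_edge x y e : symmetric e ->
  edges (del_edge x y e) = edges e :\ [set x; y].
Proof.
move=> es; apply/setP => E; rewrite in_setD1; apply/edgesP/andP.
  by case=> u [v [/andP[euv nE] ->]]; split=> //; rewrite mem_edges.
by case=> nE /edgesP[u [v [euv EE]]]; exists u, v; rewrite /= euv -EE nE.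
Qed.

Lemma card_edges_del_edge x y e : symmetric e -> e x y ->
  #|edges e| = #|edges (del_edge x y e)|.+1.
Proof.
move=> es exy; rewrite edges_del_edge // (cardsD1 [set x; y]) mem_edges //.
by rewrite exy.
Qed.

(** If x and y stay connected, connectivity does not change at all. Otherwise only the component of
    x changes, and it falls into the component of x and that of y. *)
Lemma n_comp_del_edge x y e : simple_graph e -> e x y ->
  n_comp (del_edge x y e) V
  = (n_comp e V + ~~ connect (del_edge x y e) x y)%N.
Proof.
move=> eG exy; set e' := del_edge x y e.
have eG' : simple_graph e' by exact: simple_del_edge.
have ecs := simple_connect_sym eG; have ecs' := simple_connect_sym eG'.
have sub' : subrel (connect e') (connect e).
  exact: sub_connect (@del_edge_sub x y e).
case: (boolP (connect e' x y)) => cxy /=.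
  rewrite addn0; apply: eq_n_comp => u v; apply/idP/idP; first exact: sub'.
  apply: connect_sub => {u v} u v euv.
  have [|ne] := eqVneq [set u; v] [set x; y]; last by apply/connect1/andP.
  by move/eqP; rewrite eq_set2 => /orP[] /andP[/eqP -> /eqP ->] //; rewrite ecs'.
rewrite (n_compC (connect e x) e') (n_compC (connect e x) e).
rewrite n_comp_connect //.
(* The closure of {x, y} under the smaller relation is closed under [e] as well, so it is the old
   component of x. *)
have -> : n_comp e' (connect e x) = 2.
  have := n_comp_closure2 ecs' x y; rewrite cxy => <-; apply: eq_n_comp_r => z.
  have clE : closed e (closure e' (pred2 x y)).
    apply: intro_closed => // u v euv uC.
    have [|ne] := eqVneq [set u; v] [set x; y].
      move/eqP; rewrite eq_set2 => /orP[] /andP[_ /eqP ->];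
      by apply: mem_closure; rewrite !inE eqxx ?orbT.
    by rewrite -(closure_closed ecs' (pred2 x y) (x := u)) //=; apply/andP.
  apply/idP/idP => [xz|].
    rewrite -(closed_connect clE xz); apply: mem_closure.
    by rewrite !inE eqxx.
  case/pred0Pn => w /andP[/= zw]; rewrite !inE => wE.
  have {}zw := sub' _ _ zw; rewrite ecs.
  case/orP: wE => /eqP wE; first by rewrite -wE.
  by apply: connect_trans zw _; rewrite wE connect1 // eG.1.
suff -> : n_comp e' [predC connect e x] = n_comp e [predC connect e x].
  by rewrite addnAC.
have out z : z \notin connect e x -> connect e' z =1 connect e z.
  move=> zx w; apply/idP/idP => [/sub' //|/connectP[p]].
  elim: p z zx => [|u p IHp] z zx /=; first by move=> _ ->.
  case/andP=> ezu pp wE.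
  have ux : u \notin connect e x.
    by rewrite -(connect_closed ecs x ezu).
  apply: connect_trans (IHp u ux pp wE); apply/connect1/andP; split=> //.
  rewrite eq_set2; apply: contra zx => /orP[] /andP[/eqP -> _]; rewrite inE //.
  exact: connect1.
apply: eq_card => z; rewrite !inE; case: (boolP (connect e x z)) => zx.
  by rewrite !andbF.
rewrite !andbT; congr (_ == z); congr odflt; exact: eq_pick (out z zx).
Qed.

(** * Cyclomatic number under deletion of edges and vertices *)

Lemma eq_edges e f : e =2 f -> edges e = edges f.
Proof.
by move=> ef; apply/eqP; rewrite eqEsubset !edges_sub // => x y; rewrite ef.
Qed.

(* The truncated subtraction is exact by [card_vertices_le]. *)
Definition cyc e : nat := (#|edges e| + n_comp e V - #|V|)%N.

Lemma eq_cyc e f : e =2 f -> cyc e = cyc f.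
Proof.
by move=> ef; rewrite /cyc (eq_edges ef) (eq_n_comp (eq_connect ef)).
Qed.

(** Reduces the comparison of a graph with a subgraph [e] to the removal of a single edge outside
    [e]. *)
Lemma edge_removal_ind e (P : rel V -> Prop) : symmetric e ->
    (forall f, e =2 f -> P f) ->
    (forall f x y, simple_graph f -> subrel e f -> f x y -> ~~ e x y ->
       subrel e (del_edge x y f) -> P (del_edge x y f) -> P f) ->
  forall f, simple_graph f -> subrel e f -> P f.
Proof.
move=> es P0 PS f; have [k] := ubnP #|edges f|.
elim: k f => // k IHk f lefk fG ef.
case: (boolP [exists x, exists y, f x y && ~~ e x y]).
  case/existsP => x /existsP[y /andP[fxy exy]].
  have ef' : subrel e (del_edge x y f).
    move=> u v euv; rewrite /= ef //=; apply: contra exy; rewrite eq_set2.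
    by case/orP => /andP[/eqP <- /eqP <-] //; rewrite es.
  apply: (PS f x y) => //; apply: IHk => //; last exact: simple_del_edge.
  by rewrite (card_edges_del_edge fG.1 fxy) in lefk.
rewrite negb_exists => /forallP h; apply: P0 => x y; apply/idP/idP => [/ef //|fxy].
by have := h x; rewrite negb_exists => /forallP/(_ y); rewrite fxy negbK.
Qed.

Lemma edges_rel0 : edges (fun _ _ : V => false) = set0.
Proof. by apply/setP => E; rewrite inE; apply/edgesP => -[x [y []]]. Qed.

Lemma n_comp_rel0 : n_comp (fun _ _ : V => false) V = #|V|.
Proof.
apply: eq_card => x; rewrite !inE andbT /roots.
apply/eqP; have /connectP[[|y p] //=] := connect_root (fun _ _ : V => false) x.
Qed.

(** Equality holds without edges, and an additional edge lowers the number of components by at most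
    one. *)
Lemma card_vertices_le e : simple_graph e -> (#|V| <= #|edges e| + n_comp e V)%N.
Proof.
move=> eG; have sub0 : subrel (fun _ _ => false) e by [].
move: e eG sub0; apply: edge_removal_ind => // [f ef|].
   rewrite -(eq_n_comp (eq_connect ef)) -(eq_edges ef).
  by rewrite edges_rel0 cards0 n_comp_rel0.
move=> f x y fG _ fxy _ _; rewrite (n_comp_del_edge fG fxy).
rewrite (card_edges_del_edge fG.1 fxy); case: connect => /=; lia.
Qed.

Lemma cyclomatic_numberE e : simple_graph e -> cyclomatic_number e = Posz (cyc e).
Proof.
move=> eG; have le := card_vertices_le eG.
by rewrite /cyclomatic_number /cyc -subzn // PoszD GRing.addrAC.
Qed.

Lemma cyc_del_edge x y e : simple_graph e -> e x y ->
  cyc e = (cyc (del_edge x y e) + connect (del_edge x y e) x y)%N.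
Proof.
move=> eG exy; rewrite /cyc (n_comp_del_edge eG exy).
have := card_vertices_le eG.
have := card_vertices_le (simple_del_edge x y eG).
rewrite (n_comp_del_edge eG exy) (card_edges_del_edge eG.1 exy).
case: connect => /=; lia.
Qed.

Lemma cyc_sub e f : simple_graph e -> simple_graph f -> subrel e f ->
  (cyc e <= cyc f)%N.
Proof.
move=> eG fG ef; move: f fG ef; apply: (edge_removal_ind eG.1) => [f /eq_cyc ->//|].
move=> f x y fG _ fxy _ _; rewrite (cyc_del_edge fG fxy) => /leq_trans; apply.
exact: leq_addr.
Qed.

(** Every removed edge is a bridge, which trades one edge for one component. Nonbridges of the
    smaller graph are nonbridges of [f], so the hypothesis persists. *)
Lemma cyc_del_bridges e f : simple_graph e -> simple_graph f -> subrel e f ->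
    (forall x y, nonbridge f x y -> e x y) ->
  cyc f = cyc e.
Proof.
move=> eG fG ef; move: f fG ef.
apply: (edge_removal_ind eG.1) => [f /eq_cyc -> //|f x y fG ef fxy exy ef' IH h].
rewrite (cyc_del_edge fG fxy); case: (boolP (connect _ x y)) => cxy.
  by rewrite h //= ?fxy ?cxy in exy.
rewrite addn0; apply: IH => u v /nonbridge_sub-/(_ _ (@del_edge_sub x y f)).
exact: h.
Qed.

Lemma cyc_del_nonbridge x y e : simple_graph e -> nonbridge e x y ->
  (cyc (del [set x] e) < cyc e)%N.
Proof.
move=> eG /andP[exy cxy]; rewrite (cyc_del_edge eG exy) cxy addn1 ltnS.
apply: cyc_sub; [exact: simple_del | exact: simple_del_edge|].
move=> u v /= /and3P[-> ]; rewrite !inE => ux vx /=.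
by rewrite eq_set2 (negbTE ux) (negbTE vx) andbF.
Qed.

(** The quantitative form of two cycles through x: the removal of xy costs one, and a second
    nonbridge that survives it costs another. *)
Lemma cyc_del_nonbridge2 x y z e : simple_graph e -> nonbridge e x y ->
  nonbridge (del_edge x y e) x z -> ((cyc (del [set x] e)).+1 < cyc e)%N.
Proof.
move=> eG /andP[exy cxy] nxz; rewrite (cyc_del_edge eG exy) cxy addn1 ltnS.
apply: leq_trans (cyc_del_nonbridge (simple_del_edge x y eG) nxz); rewrite ltnS.
apply: cyc_sub; [exact: simple_del | exact/simple_del/simple_del_edge|].
move=> u v /= /and3P[-> ux vx]; rewrite ux vx andbT /= eq_set2.
by move: ux vx; rewrite !inE => /negbTE -> /negbTE ->; rewrite andbF.
Qed.

(** * Cycles, nonbridges and leaves *)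

Definition forest e := forall x y, ~~ nonbridge e x y.

Lemma forest_sub e f : subrel e f -> forest f -> forest e.
Proof. by move=> ef ff x y; apply: contra (ff x y); apply: nonbridge_sub. Qed.

Lemma is_cycleP e (s : seq V) :
  reflect [/\ (3 <= size s)%N, uniq s & forall x, x \in s -> e x (next s x)]
          (is_cycle e s).
Proof.
apply: (iffP andP) => [[s3 /andP[es us]]|[s3 us es]].
  by split=> // x; apply: next_cycle.
by split=> //; rewrite /ucycleb us andbT; apply: cycle_from_next.
Qed.

Lemma mem_cycle_edges (s : seq V) x : x \in s -> [set x; next s x] \in cycle_edges s.
Proof. by move=> xs; apply/imsetP; exists x. Qed.

Lemma cycle_edges_mem (s : seq V) x y :
  [set x; y] \in cycle_edges s -> (x \in s) && (y \in s).
Proof.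
case/imsetP => z zs /eqP; rewrite eq_set2.
by case/orP => /andP[/eqP -> /eqP ->]; rewrite ?mem_next zs.
Qed.

Lemma cycle_edge_rel e (s : seq V) x y : symmetric e -> is_cycle e s ->
  [set x; y] \in cycle_edges s -> e x y.
Proof.
move=> es /is_cycleP[_ _ se] /imsetP[z zs /eqP]; rewrite eq_set2.
by case/orP => /andP[/eqP -> /eqP ->]; last rewrite es; exact: se.
Qed.

Lemma is_cycle_sub e f (s : seq V) : subrel e f -> is_cycle e s -> is_cycle f s.
Proof. by move=> ef /is_cycleP[? ? h]; apply/is_cycleP; split=> // x /h/ef. Qed.

(** Rotated to start at x, the rest of the cycle leads from the successor of x back to x without the
    edge between them. *)
Lemma cycle_nonbridge e (s : seq V) x : simple_graph e -> is_cycle e s ->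
  x \in s -> nonbridge e x (next s x).
Proof.
move=> eG /is_cycleP[s3 us es] xs; rewrite /= es //=.
rewrite (simple_connect_sym (simple_del_edge _ _ eG)).
have [i p pE] := rot_to xs.
have nE : next s =1 next (x :: p) by move=> z; rewrite -pE next_rot.
have up : uniq (x :: p) by rewrite -pE rot_uniq.
have ep : cycle e (x :: p).
  by apply: cycle_from_next => // z; rewrite -nE -pE mem_rot; apply: es.
have p3 : (3 <= size (x :: p))%N by rewrite -pE size_rot.
rewrite nE; case: p {pE nE xs} up ep p3 => // y p.
rewrite /= eqxx inE negb_or => /and3P[/andP[xy xp] yp up] /andP[_].
rewrite rcons_path => /andP[pth elx] p3.
apply: (connect_trans (y := last y p)).
  apply/connectP; exists p => //.
  apply: (@sub_in_path _ (predC1 x)) pth.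
    move=> u v ux vx /= -> /=; rewrite eq_set2.
    by move: ux vx; rewrite !inE => /negbTE -> /negbTE ->; rewrite andbF.
  apply/allP => z; rewrite !inE => /orP[/eqP ->|zp]; first by rewrite eq_sym.
  by apply: contraNneq xp => <-.
apply/connect1; rewrite /= elx /= eq_set2 eqxx andbT (negbTE xy) andbF /=.
(* With only two vertices the closing edge would be the removed edge itself; this is where the
   length bound enters. *)
case: p p3 yp {pth elx xp up} => // z p _ /=.
by apply: contra => /eqP <-; apply: mem_last.
Qed.

Lemma cycle_edge_nonbridge e (s : seq V) x y : simple_graph e -> is_cycle e s ->
  [set x; y] \in cycle_edges s -> nonbridge e x y.
Proof.
move=> eG ec /imsetP[z zs /eqP]; rewrite eq_set2.
case/orP => /andP[/eqP -> /eqP ->]; last rewrite (nonbridge_sym eG);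
exact: cycle_nonbridge.
Qed.

Lemma nonbridge_cycle e x y : simple_graph e -> nonbridge e x y ->
  exists2 s, is_cycle e s & [set x; y] \in cycle_edges s.
Proof.
move=> [es ei] /andP[exy /connectP[p0 dp0 yE]].
case: (shortenP dp0) yE => p dp up _ yE {p0 dp0}.
exists (x :: p); last first.
  rewrite setUC; have := mem_cycle_edges (mem_last x p); rewrite -yE.
  by have := cycle_next up; rewrite /cycle rcons_path -yE => /andP[_ /eqP ->].
have sub : subrel (del_edge x y e) e by exact: del_edge_sub.
rewrite /is_cycle /ucycleb up andbT; apply/andP; split; last first.
  by rewrite /= rcons_path (sub_path sub dp) /= -yE es.
(* A path with no edge would make xy a loop, and a path with one edge would be the removed edge, so
   the closed path has at least three vertices. *)
case: p yE dp {up} => [|z [|z' p]] //= yE; first by rewrite yE ei in exy.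
by rewrite -yE !eqxx /= !andbF.
Qed.

Lemma cycle_closed_sub (s t : seq V) x :
    (forall y, y \in t -> y \in s -> next t y \in s) -> uniq t ->
  x \in t -> x \in s -> {subset t <= s}.
Proof.
move=> st ut xt xs y yt; pose r := [rel u v : V | (u \in s) ==> (v \in s)].
have cr : cycle r t.
  by apply: cycle_from_next => // z zt; apply/implyP; apply: st.
have /connectP[p rp ->] := connect_cycle cr xt yt.
elim: p x xs {xt} rp => //= z p IHp x xs /andP[/implyP/(_ xs) zs rp].
exact: IHp.
Qed.

(** Otherwise every edge of t at a vertex of s is an edge of s; then s is closed under steps along
    t, contains all of t, and all edges of t belong to s. *)
Lemma shared_vertex_new_edge (s t : seq V) : uniq t -> ~~ [disjoint s & t] ->
    ~~ (cycle_edges t \subset cycle_edges s) ->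
  exists x y, [/\ x \in s, [set x; y] \in cycle_edges t
                & [set x; y] \notin cycle_edges s].
Proof.
move=> ut /pred0Pn[x /andP[/= xs xt]] nst.
pose P z y := [&& z \in s, [set z; y] \in cycle_edges t
                & [set z; y] \notin cycle_edges s].
case: (boolP [exists z, exists y, P z y]) => [|no].
  by move=> /existsP[z /existsP[y /and3P[? ? ?]]]; exists z, y.
have sub z y : z \in s -> [set z; y] \in cycle_edges t ->
    [set z; y] \in cycle_edges s.
  move=> zs zy; apply: contraNT no => nE.
  by apply/existsP; exists z; apply/existsP; exists y; rewrite /P zs zy.
have st : {subset t <= s}.
  apply: (cycle_closed_sub _ ut xt xs) => y yt ys.
  by have /cycle_edges_mem/andP[] := sub _ _ ys (mem_cycle_edges yt).
case/negP: nst; apply/subsetP => E /imsetP[z zt ->].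
by apply: sub; [apply: st | apply: mem_cycle_edges].
Qed.

(** An edge xy of t that is not an edge of s can be removed without destroying s, so x keeps a
    nonbridge on s. As the edge sets differ, one of them is not contained in the other, and the
    roles of s and t are chosen accordingly. *)
Lemma shared_cycles e (s t : seq V) : simple_graph e ->
    is_cycle e s -> is_cycle e t -> cycle_edges s != cycle_edges t ->
    ~~ [disjoint s & t] ->
  exists x y, nonbridge e x y /\ ((cyc (del [set x] e)).+1 < cyc e)%N.
Proof.
move=> eG; have key (s' t' : seq V) : is_cycle e s' -> is_cycle e t' ->
    ~~ [disjoint s' & t'] -> ~~ (cycle_edges t' \subset cycle_edges s') ->
  exists x y, nonbridge e x y /\ ((cyc (del [set x] e)).+1 < cyc e)%N.
  move=> cs ct dst nst; have /is_cycleP[s3 us es] := cs.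
  have /is_cycleP[_ ut _] := ct.
  have [x [y [xs xyt xys]]] := shared_vertex_new_edge ut dst nst.
  have nxy := cycle_edge_nonbridge eG ct xyt; exists x, y; split=> //.
  apply: (@cyc_del_nonbridge2 x y (next s' x)) => //.
  apply: cycle_nonbridge => //; first exact: simple_del_edge.
  apply/is_cycleP; split=> // z zs; rewrite /= es //=.
  by apply: contraNneq xys => <-; apply: mem_cycle_edges.
move=> cs ct; rewrite eqEsubset negb_and => /orP[nst|nts] dst; last exact: key nts.
by apply: key nst => //; rewrite disjoint_sym.
Qed.

(* The size of the component of w after deletion of the edge uw. This number
   decreases along walks through bridges, which replaces longest paths. *)
Definition branch e u w := #|connect (del_edge u w e) w|.

(** As ab is a bridge with w on the side of a, the side of b avoids w and hence the edge uw. It can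
    be reached from w through a, so it lies in the component of w, from which it misses w itself. *)
Lemma branch_lt e u w a b : simple_graph e -> e a b -> ~~ nonbridge e a b ->
    connect (del_edge u w e) w a -> [set a; b] != [set u; w] ->
    connect (del_edge a b e) a w ->
  (branch e a b < branch e u w)%N.
Proof.
move=> eG eab nab cwa neq caw.
have sab := simple_connect_sym (simple_del_edge a b eG).
have ncab : ~~ connect (del_edge a b e) a b by move: nab; rewrite /= eab.
have nbw z : connect (del_edge a b e) b z -> z != w.
  move=> bz; apply: contraNneq ncab => zw.
  by rewrite sab; apply: (connect_trans bz); rewrite zw sab.
apply: proper_card; apply/properP; split; last first.
  exists w; first exact: connect0.
  by apply/negP => /nbw; rewrite eqxx.
apply/subsetP => v bv; apply: connect_trans cwa _.
apply: (@connect_trans _ _ b); first by apply: connect1; rewrite /= eab.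
have /connectP[p pb ->] : connect (del_edge a b e) b v by [].
suff gen y : connect (del_edge a b e) b y -> path (del_edge a b e) y p ->
    connect (del_edge u w e) y (last y p) by apply: gen.
elim: p y {pb} => //= z p IHp y yb /andP[/andP[eyz nyz] pz].
have bz : connect (del_edge a b e) b z.
  by apply: connect_trans yb _; apply: connect1; rewrite /= eyz.
apply: connect_trans (IHp z bz pz); apply: connect1; rewrite /= eyz /= eq_set2.
by rewrite (negbTE (nbw _ yb)) (negbTE (nbw _ bz)) andbF.
Qed.

(** In an edge uw with minimal branch, w is a leaf: another neighbour v of w would give wv a smaller
    branch. *)
Lemma forest_leaf e u0 w0 : simple_graph e -> forest e -> e u0 w0 ->
  exists u w, e u w /\ forall v, e w v -> v = u.
Proof.
move=> eG fe e0.
have [[u w] /= euw umin] := @arg_minnP _ (u0, w0) (fun p => e p.1 p.2)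
  (fun p => branch e p.1 p.2) e0.
exists u, w; split=> // v ewv; apply: contraTeq isT => vu.
have : (branch e w v < branch e u w)%N.
  apply: branch_lt => //.
  rewrite eq_set2 (negbTE vu) andbF orbF.
  by apply/negP => /andP[_ /eqP vw]; move: ewv; rewrite vw eG.2.
by rewrite ltnNge (umin (w, v)).
Qed.

(** * Matchings *)

Implicit Types M N : {set {set V}}.

Lemma matching_number_witness e :
  exists M, matching e M /\ #|M| = matching_number e.
Proof.
have P0 : matching e set0.
  by rewrite /matching sub0set; apply/trivIsetP => A B; rewrite inE.
rewrite /matching_number (bigop.bigmax_eq_arg set0 P0).
by case: arg_maxnP => // M mM _; exists M.
Qed.

Lemma matching_number_max e M : matching e M -> (#|M| <= matching_number e)%N.
Proof. exact: (leq_bigmax_cond (F := fun M : {set {set V}} => #|M|)). Qed.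

Lemma matching_sub e f M N : M \subset N -> M \subset edges f ->
  matching e N -> matching f M.
Proof.
move=> MN Mf /andP[_ /trivIsetP tN]; rewrite /matching Mf /=.
by apply/trivIsetP => A B /(subsetP MN) AN /(subsetP MN) BN; apply: tN.
Qed.

Lemma matching_number_sub e f : subrel e f ->
  (matching_number e <= matching_number f)%N.
Proof.
move=> ef; have [M [mM <-]] := matching_number_witness e.
apply: matching_number_max; apply: (matching_sub _ _ mM) => //.
by have /andP[Me _] := mM; apply: subset_trans Me (edges_sub ef).
Qed.

Lemma eq_matching_number e f : e =2 f -> matching_number e = matching_number f.
Proof.
by move=> ef; apply/eqP; rewrite eqn_leq !matching_number_sub // => x y; rewrite ef.
Qed.

Lemma matching_number_leD e f g : (forall x y, e x y -> f x y || g x y) ->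
  (matching_number e <= matching_number f + matching_number g)%N.
Proof.
move=> efg; have [M [mM <-]] := matching_number_witness e.
rewrite -(cardsID (edges f) M); apply: leq_add; apply: matching_number_max.
  by apply: (matching_sub _ _ mM); rewrite ?subsetIl ?subsetIr.
apply: (matching_sub _ _ mM); rewrite ?subsetDl //.
apply/subsetP => E /setDP[EM nEf]; have /andP[/subsetP/(_ _ EM) + _] := mM.
case/edgesP => x [y [exy EE]]; apply/edgesP; exists x, y; split=> //.
have := efg _ _ exy; case: (boolP (f x y)) => //= fxy.
by case/negP: nEf; apply/edgesP; exists x, y.
Qed.

Lemma trivIset_card_hit M A : trivIset M ->
  (forall E, E \in M -> E :&: A != set0) -> (#|M| <= #|A|)%N.
Proof.
move=> /trivIsetP tM hit; pose f E := [pick x in E :&: A].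
have fP E : E \in M -> exists2 x, f E = Some x & x \in E :&: A.
  move=> EM; rewrite /f; case: pickP => [x xE|no]; first by exists x.
  by have /set0Pn[x] := hit E EM; rewrite no.
have finj : {in M &, injective f}.
  move=> E F EM FM fE; apply/eqP; apply: contraT => neq.
  have [x fEx xE] := fP E EM; have [y fFy yF] := fP F FM.
  have [xy] : Some x = Some y by rewrite -fEx -fFy.
  have /pred0P/(_ x) := tM E F EM FM neq.
  by move: xE yF; rewrite -xy !inE /= => /andP[-> _] /andP[-> _].
have sinj : injective (@Some V) by move=> x y [].
rewrite -(card_in_imset finj) -(card_imset [in A] sinj).
apply/subset_leq_card/subsetP => _ /imsetP[E EM ->]; have [x -> /setIP[_ xA]] := fP E EM.
exact: imset_f.
Qed.

Lemma matching_number_hit e A : (forall x y, e x y -> (x \in A) || (y \in A)) ->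
  (matching_number e <= #|A|)%N.
Proof.
move=> eA; have [M [/andP[/subsetP Me tM] <-]] := matching_number_witness e.
apply: trivIset_card_hit tM _ => E /Me/edgesP[x [y [/eA + ->]]].
by case/orP => zA; apply/set0Pn; [exists x | exists y]; rewrite !inE eqxx ?orbT zA.
Qed.

Lemma matching_number_del A e :
  (matching_number e <= matching_number (del A e) + #|A|)%N.
Proof.
pose g x y := e x y && ((x \in A) || (y \in A)).
have efg x y : e x y -> del A e x y || g x y.
  by move=> exy; rewrite /g /= exy; case: (x \in A); case: (y \in A).
apply: leq_trans (matching_number_leD efg) _; rewrite leq_add2l.
by apply: matching_number_hit => x y /andP[].
Qed.

Lemma card_cover_matching e M : simple_graph e -> matching e M ->
  #|cover M| = (2 * #|M|)%N.
Proof.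
move=> eG /andP[/subsetP Me /eqP <-]; rewrite mulnC -sum_nat_const.
apply: eq_bigr => E /Me/edgesP[x [y [exy ->]]]; rewrite cards2.
by case: eqP exy => // <-; rewrite eG.2.
Qed.

Lemma matching_number_half e A : simple_graph e ->
    (forall x y, e x y -> (x \in A) && (y \in A)) ->
  (matching_number e <= #|A|./2)%N.
Proof.
move=> eG eA; have [M [mM <-]] := matching_number_witness e.
rewrite -[#|M|]doubleK half_leq // -mul2n -(card_cover_matching eG mM).
apply/subset_leq_card/bigcupsP => E EM.
have /andP[/subsetP/(_ _ EM) + _] := mM.
by move=> /edgesP[x [y [/eA/andP[xA yA] ->]]]; apply/subsetP => z /set2P[] ->.
Qed.

Lemma coverP M x : reflect (exists2 E, E \in M & x \in E) (x \in cover M).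
Proof. by apply: (iffP bigcupP) => -[E]; exists E. Qed.

Lemma matching_add e M x y : matching e M -> e x y ->
    x \notin cover M -> y \notin cover M ->
  matching e ([set x; y] |: M) /\ #|[set x; y] |: M| = #|M|.+1.
Proof.
move=> /andP[Me tM] exy xM yM; split.
  apply/andP; split.
    by rewrite subUset Me sub1set andbT; apply/edgesP; exists x, y.
  have dis F : F \in M -> [disjoint [set x; y] & F].
    move=> FM; apply/pred0P => z; apply/negP => /andP[/set2P[] -> zF].
      by case/negP: xM; apply/coverP; exists F.
    by case/negP: yM; apply/coverP; exists F.
  apply/trivIsetP => E F /setU1P[->|EM] /setU1P[->|FM] neq.
  - by rewrite eqxx in neq.
  - exact: dis.
  - by rewrite disjoint_sym dis.
  - exact: (trivIsetP tM).
rewrite cardsU1; have [xyM|//] := boolP ([set x; y] \in M).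
by case/negP: xM; apply/coverP; exists [set x; y]; rewrite ?set21.
Qed.

Lemma cover_matching e M x : matching e M -> x \in cover M -> exists y, e x y \/ e y x.
Proof.
case/andP=> /subsetP Me _ /coverP[E /Me/edgesP[u [v [euv ->]]] /set2P[] ->].
  by exists v; left.
by exists u; right.
Qed.

Lemma matching_number_del2 e x y : e x y ->
  (matching_number (del [set x; y] e) < matching_number e)%N.
Proof.
move=> exy; have [M [mM <-]] := matching_number_witness (del [set x; y] e).
have mM' : matching e M.
  apply: (matching_sub _ _ mM) => //; have /andP[Me _] := mM.
  exact: subset_trans Me (edges_sub (@del_sub _ e)).
have out z : z \in [set x; y] -> z \notin cover M.
  move=> zxy; apply/negP => /(cover_matching mM)[w] /=.
  by rewrite zxy /= !andbF; case.
have [mA <-] := matching_add mM' exy (out x (set21 x y)) (out y (set22 x y)).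
exact: matching_number_max.
Qed.

Lemma matching_number_disjoint e f g : symmetric f ->
    subrel e g -> subrel f g -> (forall x y z, e x y -> f x z -> False) ->
    symmetric e ->
  (matching_number e + matching_number f <= matching_number g)%N.
Proof.
move=> fs eg fg dis es.
have [M [mM <-]] := matching_number_witness e.
have [N [mN <-]] := matching_number_witness f.
have dMN E F : E \in M -> F \in N -> [disjoint E & F].
  move=> EM FN; apply/pred0P => x; apply/negP => /andP[xE xF].
  have xM : x \in cover M by apply/coverP; exists E.
  have xN : x \in cover N by apply/coverP; exists F.
  have [y exy] := cover_matching mM xM; have [z exz] := cover_matching mN xN.
  by apply: (dis x y z); [case: exy | case: exz] => //; rewrite 1?es 1?fs.
have -> : (#|M| + #|N| = #|M :|: N|)%N.
  rewrite cardsU [M :&: N](_ : _ = set0) ?cards0 ?subn0 //.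
  apply/setP => E; rewrite !inE; apply/negP => /andP[EM EN].
  have := dMN E E EM EN; rewrite -setI_eq0 setIid => /eqP E0.
  have /andP[/subsetP/(_ _ EM)/edgesP[x [y [_ EE]]] _] := mM.
  by have := set21 x y; rewrite -EE E0 inE.
apply: matching_number_max; have /andP[Me /trivIsetP tM] := mM.
have /andP[Nf /trivIsetP tN] := mN; apply/andP; split.
  by rewrite subUset (subset_trans Me) ?(subset_trans Nf) ?edges_sub.
apply/trivIsetP => E F /setUP[EM|EN] /setUP[FM|FN] neq.
- exact: tM.
- exact: dMN.
- by rewrite disjoint_sym dMN.
- exact: tN.
Qed.

(** Deleting u isolates the leaf w, so it amounts to deleting both ends of the edge uw. *)
Lemma matching_number_leaf e u w : e u w -> (forall v, e w v -> v = u) ->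
    simple_graph e ->
  (matching_number (del [set u] e) < matching_number e)%N.
Proof.
move=> euw wu eG; apply: leq_ltn_trans (matching_number_del2 euw).
apply: matching_number_sub => x y /= /and3P[exy]; rewrite !inE exy => xu yu /=.
rewrite (negbTE xu) (negbTE yu) /=; apply/andP; split.
  by apply: contra yu => /eqP xw; apply/eqP/wu; rewrite -xw.
by apply: contra xu => /eqP yw; apply/eqP/wu; rewrite -yw eG.1.
Qed.

Lemma path_matching e (s : seq V) : simple_graph e -> uniq s -> sorted e s ->
  exists M, [/\ matching e M, cover M \subset [set x in s] & #|M| = (size s)./2].
Proof.
move=> eG; have [k] := ubnP (size s); elim: k s => // k IHk [|x [|y s]] /= lek.
- move=> _ _; exists set0; split; rewrite ?cards0 //.
    by rewrite /matching sub0set; apply/trivIsetP => A B; rewrite inE.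
  by rewrite /cover big_set0 sub0set.
- move=> _ _; exists set0; split; rewrite ?cards0 //.
    by rewrite /matching sub0set; apply/trivIsetP => A B; rewrite inE.
  by rewrite /cover big_set0 sub0set.
rewrite inE negb_or => /and3P[/andP[xy xs] ys us] /andP[exy /path_sorted ss].
have [|M [mM cM sM]] := IHk s _ us ss; first by lia.
have xM : x \notin cover M by apply: contra xs => /(subsetP cM); rewrite inE.
have yM : y \notin cover M by apply: contra ys => /(subsetP cM); rewrite inE.
have [mA cA] := matching_add mM exy xM yM; exists ([set x; y] |: M).
rewrite mA cA sM; split=> //; apply/bigcupsP => E /setU1P[->|EM].
  by apply/subsetP => z /set2P[] ->; rewrite !inE eqxx ?orbT.
apply/subsetP => z zE; have zM : z \in cover M by apply/coverP; exists E.
by have := subsetP cM _ zM; rewrite !inE => ->; rewrite !orbT.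
Qed.

Lemma matching_number_cycle e (s : seq V) : simple_graph e -> is_cycle e s ->
  ((size s)./2 <= matching_number e)%N.
Proof.
move=> eG /andP[_ /andP[cs us]]; have ss : sorted e s.
  by case: s cs {us} => //= x s; rewrite rcons_path => /andP[].
by have [M [mM _ <-]] := path_matching eG us ss; apply: matching_number_max.
Qed.

(* If both ends x and z were avoidable, maximum matchings of the two sides of
   the bridge avoiding x and z could be extended by the edge xz. *)
Lemma bridge_end_essential e x z : simple_graph e -> e x z ->
    ~~ nonbridge e x z -> matching_number (del [set x] e) = matching_number e ->
  (matching_number (del [set z] e) < matching_number e)%N.
Proof.
move=> eG exz; rewrite /= exz /= => nxz mx; rewrite ltnNge; apply/negP => mz.
pose d := del_edge x z e; have dG : simple_graph d by exact: simple_del_edge.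
have [ds _] := dG; pose K v := connect d x v.
have Kd u v : d u v -> K u = K v.
  by move=> duv; apply: same_connect_r; [exact: simple_connect_sym | exact: connect1].
pose eK u v := d u v && K u; pose eL u v := d u v && ~~ K u.
have eKs : symmetric eK by move=> u v; rewrite /eK ds; case: (boolP (d v u)) => // /Kd ->.
have eLs : symmetric eL by move=> u v; rewrite /eL ds; case: (boolP (d v u)) => // /Kd ->.
have de u v : d u v -> e u v by exact: del_edge_sub.
have Kx : K x by exact: connect0.
have Kz : ~~ K z by [].
(* With K the side of x and L the side of z, the four bounds add up to 2 m(e) <= m(K - x) + m(L) +
   m(K) + m(L - z) <= m(e) + m(e - x - z), while m(e - x - z) < m(e) because of the edge xz. *)
have h1 : (matching_number (del [set x] e)
           <= matching_number (del [set x] eK) + matching_number eL)%N.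
  apply: matching_number_leD => u v /= /and3P[euv ux vx].
  rewrite /eK /eL ux vx /d /= euv /= eq_set2.
  move: ux vx; rewrite !inE => /negbTE -> /negbTE -> /=.
  by rewrite !andbF /= andbT; case: (K u).
have h2 : (matching_number (del [set z] e)
           <= matching_number eK + matching_number (del [set z] eL))%N.
  apply: matching_number_leD => u v /= /and3P[euv ux vx].
  rewrite /eK /eL ux vx /d /= euv /= eq_set2.
  move: ux vx; rewrite !inE => /negbTE -> /negbTE -> /=.
  by rewrite !andbF /= andbT; case: (K u).
have h3 : (matching_number eK + matching_number eL <= matching_number e)%N.
  apply: matching_number_disjoint => //.
  - by move=> u v /andP[/de].
  - by move=> u v /andP[/de].
  - by move=> u v w /andP[_ Ku] /andP[_]; rewrite Ku.
have h4 : (matching_number (del [set x] eK) + matching_number (del [set z] eL)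
           <= matching_number (del [set x; z] e))%N.
  apply: matching_number_disjoint.
  - by move=> u v; rewrite /= eLs [X in _ && X]andbC.
  - move=> u v /= /and3P[/andP[duv Ku]]; rewrite !inE => ux vx.
    rewrite (de _ _ duv) (negbTE ux) (negbTE vx) /=; apply/andP; split.
      by apply: contraNneq Kz => <-.
    by apply: contraNneq Kz => <-; rewrite -(Kd _ _ duv).
  - move=> u v /= /and3P[/andP[duv Ku]]; rewrite !inE => ux vx.
    rewrite (de _ _ duv) (negbTE ux) (negbTE vx) !orbF /=; apply/andP; split.
      by apply: contraNneq Ku => ->.
    by apply: contraNneq Ku => vE; rewrite (Kd _ _ duv) vE.
  - by move=> u v w /= /andP[/andP[_ Ku] _] /andP[/andP[_]]; rewrite Ku.
  - by move=> u v; rewrite /= eKs [X in _ && X]andbC.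
have := matching_number_del2 exz; lia.
Qed.

Lemma card_edges_sub e f x y : symmetric e -> subrel e f -> f x y -> ~~ e x y ->
  (#|edges e| < #|edges f|)%N.
Proof.
move=> es ef fxy exy; apply: proper_card; rewrite properE edges_sub //=.
have xyf : [set x; y] \in edges f by apply/edgesP; exists x, y.
by apply/negP => /subsetP/(_ _ xyf); rewrite mem_edges // (negbTE exy).
Qed.

(** Koenig's theorem for forests: the neighbour of a leaf goes into the cover, and its deletion
    lowers the matching number. *)
Lemma forest_cover e : simple_graph e -> forest e ->
  exists A, (#|A| <= matching_number e)%N /\
    forall x y, e x y -> (x \in A) || (y \in A).
Proof.
have [k] := ubnP #|edges e|; elim: k e => // k IHk e lek eG fe.
case: (boolP [exists x, exists y, e x y]) => [|no]; last first.
  exists set0; rewrite cards0; split=> // x y exy; case/negP: no.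
  by apply/existsP; exists x; apply/existsP; exists y.
case/existsP => x /existsP[y exy]; have [u [w [euw wu]]] := forest_leaf eG fe exy.
have [|||A [cA AP]] := IHk (del [set u] e).
- rewrite ltnS in lek; apply: leq_trans lek.
  apply: (card_edges_sub (simple_del _ eG).1 (@del_sub _ e) euw).
  by rewrite /= inE eqxx andbF.
- exact: simple_del.
- by apply: forest_sub fe; apply: del_sub.
exists (u |: A); split.
  apply: leq_trans (matching_number_leaf euw wu eG).
  by rewrite cardsU1; case: (u \in A); rewrite ?add0n ?add1n ?ltnS // leqW.
move=> v z evz; rewrite !inE; have [->//|vu] := eqVneq v u.
have [->|zu] := eqVneq z u; first by rewrite /= orbT.
by apply: AP; rewrite /= evz !inE vu zu.
Qed.

End Graphs.

Arguments del V A e x y /.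
Arguments del_edge V x y e u v /.
Arguments nonbridge V e x y /.

(** * Cycles and the contraction *)

Section CyclesAndBlocks.

Variable V : finType.
Implicit Types (e f : rel V) (x y z u v w : V) (A B : {set V}) (s t : seq V).

Lemma disjoint_cycles_sub e f : subrel e f -> disjoint_cycles f -> disjoint_cycles e.
Proof.
by move=> ef df s t /(is_cycle_sub ef) cs /(is_cycle_sub ef) ct; apply: df.
Qed.

Lemma cycle_supportsP e A :
  reflect (exists2 s, is_cycle e s & A = [set x in s]) (A \in cycle_supports e).
Proof.
rewrite inE; apply: (iffP existsP) => [[s /andP[cs /eqP <-]]|[s cs AE]].
  by exists s.
have /is_cycleP[_ us _] := cs.
have sz : size s == #|A| by rewrite AE cardsE; apply/eqP/esym/card_uniqP.
by exists (Tuple sz); rewrite cs /= -AE.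
Qed.

Lemma cycle_verticesP e x :
  reflect (exists2 s, is_cycle e s & x \in s) (x \in cycle_vertices e).
Proof.
apply: (iffP (coverP _ _)) => [[A +]|[s cs xs]].
  by case/(cycle_supportsP e A) => s cs ->; rewrite inE; exists s.
by exists [set y in s]; [apply/cycle_supportsP; exists s | rewrite inE].
Qed.

Lemma nonbridge_cycle_vertices e x y : simple_graph e -> nonbridge e x y ->
  (x \in cycle_vertices e) /\ (y \in cycle_vertices e).
Proof.
move=> eG /(nonbridge_cycle eG)[s cs /cycle_edges_mem/andP[xs ys]].
by split; apply/cycle_verticesP; exists s.
Qed.

Lemma cycle_vertices_nonbridge e x : simple_graph e -> x \in cycle_vertices e ->
  exists y, nonbridge e x y.
Proof.
by move=> eG /cycle_verticesP[s cs xs]; exists (next s x); apply: cycle_nonbridge.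
Qed.

Lemma cycle_vertices_sub e f : subrel e f ->
  {subset cycle_vertices e <= cycle_vertices f}.
Proof.
move=> ef x /cycle_verticesP[s cs xs]; apply/cycle_verticesP; exists s => //.
exact: is_cycle_sub cs.
Qed.

Lemma is_cycle_del A e s : {in s, forall x, x \notin A} -> is_cycle e s ->
  is_cycle (del A e) s.
Proof.
move=> sA /is_cycleP[s3 us es]; apply/is_cycleP; split=> // x xs.
by rewrite /= es // !sA // mem_next.
Qed.

Lemma nonbridge_del A e x y : simple_graph e ->
    {in cycle_vertices e, forall x, x \notin A} -> nonbridge e x y ->
  nonbridge (del A e) x y.
Proof.
move=> eG OA /(nonbridge_cycle eG)[s cs xys].
apply: (cycle_edge_nonbridge (simple_del A eG) _ xys); apply: (is_cycle_del _ cs).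
by move=> z zs; apply: OA; apply/cycle_verticesP; exists s.
Qed.

Lemma nonbridge_cycle_edge e s x y : simple_graph e -> disjoint_cycles e ->
  is_cycle e s -> x \in s -> nonbridge e x y -> [set x; y] \in cycle_edges s.
Proof.
move=> eG de cs xs /(nonbridge_cycle eG)[t ct xyt].
have [-> //|neq] := eqVneq (cycle_edges s) (cycle_edges t).
have /pred0P/(_ x) := de s t cs ct neq.
by have /andP[xt _] := cycle_edges_mem xyt; rewrite /= xs xt.
Qed.

(** A nonbridge at a vertex of s lies on a cycle that meets s, and by disjointness this cycle has
    the edges of s; hence no edge leaves s. *)
Lemma cycle_component_closed e s x y : simple_graph e -> disjoint_cycles e ->
  subrel e (nonbridge e) -> is_cycle e s -> e x y -> (x \in s) = (y \in s).
Proof.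
move=> eG de eO cs exy; have nxy := eO _ _ exy.
apply/idP/idP => [xs|ys].
  by have /cycle_edges_mem/andP[] := nonbridge_cycle_edge eG de cs xs nxy.
rewrite (nonbridge_sym eG) in nxy.
by have /cycle_edges_mem/andP[] := nonbridge_cycle_edge eG de cs ys nxy.
Qed.

(** The induction step for disjoint unions of cycles. Removing the edge xy costs exactly one in the
    cyclomatic number, and afterwards the other edges at s are bridges, whose removal costs
    nothing. *)
Lemma peel_cycle e x y : simple_graph e -> disjoint_cycles e ->
    subrel e (nonbridge e) -> e x y ->
  exists s, [/\ is_cycle e s, x \in s,
    subrel (del [set z in s] e) (nonbridge (del [set z in s] e))
    & cyc e = (cyc (del [set z in s] e)).+1].
Proof.
move=> eG de eO exy.
have [s cs xys] := nonbridge_cycle eG (eO _ _ exy).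
have /andP[xs ys] := cycle_edges_mem xys; exists s; split=> //.
  move=> u v /and3P[euv]; rewrite !inE => us vs.
  have [t ct uvt] := nonbridge_cycle eG (eO _ _ euv).
  apply: (cycle_edge_nonbridge (simple_del _ eG) _ uvt); apply: (is_cycle_del _ ct) => z zt.
  rewrite inE; apply/negP => zs.
  have [est|neq] := eqVneq (cycle_edges s) (cycle_edges t).
    by rewrite -est in uvt; have /cycle_edges_mem/andP[] := uvt; rewrite (negbTE us).
  by have /pred0P/(_ z) := de s t cs ct neq; rewrite /= zs zt.
rewrite (cyc_del_edge eG exy); have /andP[_ ->] := eO _ _ exy.
rewrite addn1; congr _.+1.
have dG := simple_del_edge x y eG.
(* A cycle through u that avoids xy would meet s, hence have the edges of s, among them xy. *)
have key u v : u \in s -> ~~ nonbridge (del_edge x y e) u v.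
  move=> us; apply/negP => /(nonbridge_cycle dG)[t ct uvt].
  have /andP[ut _] := cycle_edges_mem uvt.
  have ct' := is_cycle_sub (@del_edge_sub _ x y e) ct.
  have [est|neq] := eqVneq (cycle_edges s) (cycle_edges t).
    rewrite est in xys; have := cycle_edge_rel dG.1 ct xys.
    by rewrite /= eqxx andbF.
  by have /pred0P/(_ u) := de s t cs ct' neq; rewrite /= us ut.
apply: cyc_del_bridges => //; first exact: simple_del.
  move=> u v /= /and3P[-> us vs] /=; rewrite eq_set2; move: us vs; rewrite !inE => us vs.
  by apply/negP => /orP[] /andP[/eqP uE _]; move: us; rewrite uE ?xs ?ys.
move=> u v nuv /=; have /andP[/andP[-> _] _] := nuv; rewrite !inE /=.
apply/andP; split; apply: contraTN nuv => ins; first exact: key.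
by rewrite (nonbridge_sym dG); apply: key.
Qed.

Lemma card_edges_del e A x y : simple_graph e -> e x y -> x \in A ->
  #|edges (del A e)| < #|edges e|.
Proof.
move=> eG exy xA; apply: (card_edges_sub (simple_del A eG).1 (@del_sub _ A e) exy).
by rewrite /= xA andbF.
Qed.

(** Peels off one cycle at a time: a cycle with q vertices contributes at least floor(q/2) to the
    matching number and one to the cyclomatic number. *)
Lemma card_cycle_vertices_le e : simple_graph e -> disjoint_cycles e ->
    subrel e (nonbridge e) ->
  #|cycle_vertices e| <= 2 * matching_number e + cyc e.
Proof.
have [k] := ubnP #|edges e|; elim: k e => // k IHk e lek eG de eO.
case: (boolP [exists x, exists y, e x y]) => [|no]; last first.
  rewrite [cycle_vertices e](_ : _ = set0) ?cards0 //; apply/setP => x.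
  rewrite in_set0; apply/negP => /(cycle_vertices_nonbridge eG)[y /andP[exy _]].
  by case/negP: no; apply/existsP; exists x; apply/existsP; exists y.
case/existsP => x /existsP[y exy].
have [s [cs xs eO' cE]] := peel_cycle eG de eO exy.
set S := [set z in s] in eO' cE; have eG' := simple_del S eG.
have /is_cycleP[_ us _] := cs.
have cS : #|S| = size s by rewrite cardsE; apply/card_uniqP.
have := IHk (del S e) _ eG' (disjoint_cycles_sub (@del_sub _ S e) de) eO'.
have -> : (#|edges (del S e)| < k)%N.
  by rewrite ltnS in lek; apply: leq_trans lek; apply: (card_edges_del eG exy); rewrite inE.
move=> /(_ isT) IH.
have OE : cycle_vertices e \subset S :|: cycle_vertices (del S e).
  apply/subsetP => z /(cycle_vertices_nonbridge eG)[w /andP[ezw _]]; rewrite !inE.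
  case: (boolP (z \in s)) => //= zs; have ws := zs.
  rewrite (cycle_component_closed eG de eO cs ezw) in ws.
  have dzw : del S e z w by rewrite /= ezw !inE zs ws.
  by have [] := nonbridge_cycle_vertices eG' (eO' _ _ dzw).
have le1 := leq_trans (subset_leq_card OE) (leq_card_setU _ _).
pose f u v := [&& e u v, u \in s & v \in s].
have fG : simple_graph f.
  split=> [u v|u]; rewrite /f ?eG.2 // eG.1.
  by rewrite [X in _ && X]andbC.
have cf : is_cycle f s.
  have /is_cycleP[s3 _ es] := cs; apply/is_cycleP; split=> // u us'.
  by rewrite /f es // mem_next us'.
have le2 : (matching_number f + matching_number (del S e) <= matching_number e)%N.
  apply: matching_number_disjoint.
  - exact: eG'.1.
  - by move=> u v /and3P[].
  - exact: del_sub.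
  - by move=> u v w /and3P[_ us' _] /= /and3P[_]; rewrite inE us'.
  - exact: fG.1.
have le3 := matching_number_cycle fG cf.
rewrite cS in le1; lia.
Qed.

(** * The contraction is a forest *)

Definition block e B := B \in contraction_vertices e.

Lemma blockP e B : reflect
  ((exists2 s, is_cycle e s & B = [set x in s]) \/
   exists2 x, x \notin cycle_vertices e & B = [set x]) (block e B).
Proof.
apply: (iffP setUP) => -[].
- by move/(cycle_supportsP e B); left.
- by move=> /imsetP[x]; rewrite inE => xO ->; right; exists x.
- by move=> h; left; apply/cycle_supportsP.
- by case=> x xO ->; right; apply/imsetP; exists x; rewrite ?inE.
Qed.

Lemma block_neq0 e B : block e B -> exists x, x \in B.
Proof.
case/blockP => [[s /andP[s3 _] ->]|[x _ ->]]; last by exists x; rewrite inE.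
by case: s s3 => // x s _; exists x; rewrite !inE eqxx.
Qed.

Lemma block_cycle e s x B : disjoint_cycles e -> is_cycle e s ->
  x \in s -> block e B -> x \in B -> B = [set z in s].
Proof.
move=> de cs xs /blockP[[t ct ->]|[y yO ->]]; last first.
  by rewrite inE => /eqP xy; case/negP: yO; apply/cycle_verticesP; exists s; rewrite -?xy.
rewrite inE => xt; have [est|neq] := eqVneq (cycle_edges s) (cycle_edges t); last first.
  by have /pred0P/(_ x) := de s t cs ct neq; rewrite /= xs xt.
apply/setP => z; rewrite !inE; apply/idP/idP => zz.
  by have /cycle_edges_mem/andP[] : [set z; next t z] \in cycle_edges s
    by rewrite est mem_cycle_edges.
by have /cycle_edges_mem/andP[] : [set z; next s z] \in cycle_edges t
  by rewrite -est mem_cycle_edges.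
Qed.

Lemma block_uniq e x B B' : disjoint_cycles e -> block e B -> block e B' ->
  x \in B -> x \in B' -> B = B'.
Proof.
move=> de bB bB' xB xB'; have /blockP[[s cs BE]|[y yO BE]] := bB.
  have xs : x \in s by rewrite BE inE in xB.
  by rewrite BE (block_cycle de cs xs bB' xB').
have /blockP[[s cs BE']|[z zO BE']] := bB'.
  have xs : x \in s by rewrite BE' inE in xB'.
  by rewrite BE' (block_cycle de cs xs bB xB).
by move: xB xB'; rewrite BE BE' !inE => /eqP -> /eqP ->.
Qed.

(** A bridge is no edge of a cycle, so the cycles survive its removal. *)
Lemma block_connect e x y B u v : simple_graph e -> disjoint_cycles e ->
    ~~ nonbridge e x y -> block e B -> u \in B -> v \in B ->
  connect (del_edge x y e) u v.
Proof.
move=> eG de nxy /blockP[[s cs ->]|[z _ ->]]; rewrite !inE; last first.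
  by move=> /eqP -> /eqP ->; apply: connect0.
apply: connect_cycle; apply: cycle_from_next; have /is_cycleP[_ us es] := cs => // z zs.
rewrite /= es //=; apply: contraNneq nxy => eq_xy.
by apply: (cycle_edge_nonbridge eG cs); rewrite -eq_xy mem_cycle_edges.
Qed.

Lemma contraction_edge_bridge e B B' x y : simple_graph e -> disjoint_cycles e ->
    block e B -> block e B' -> B != B' -> x \in B -> y \in B' ->
  ~~ nonbridge e x y.
Proof.
move=> eG de bB bB' neq xB yB'; apply: contraNN neq => nxy.
have [s cs /cycle_edges_mem/andP[xs ys]] := nonbridge_cycle eG nxy.
by rewrite (block_cycle de cs xs bB xB) (block_cycle de cs ys bB' yB').
Qed.

Lemma simple_contraction e : simple_graph e -> simple_graph (@contraction _ e).
Proof.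
move=> eG; split=> [B B'|B]; rewrite /contraction ?eqxx // eq_sym; congr (_ && _).
apply/existsP/existsP => -[x /andP[xB /existsP[y /andP[yB exy]]]];
  by exists y; rewrite yB; apply/existsP; exists x; rewrite xB eG.1.
Qed.

(** A walk in the contraction that avoids the edge B1 B2 lifts to a walk in the graph that avoids a
    bridge xy between these blocks, since inside each block one can move without using xy. *)
Lemma contraction_forest e : simple_graph e -> disjoint_cycles e ->
  forest (@contraction _ e).
Proof.
move=> eG de B1 B2; apply/negP => /andP[/andP[neq]].
case/existsP => x /andP[xB1 /existsP[y /andP[yB2 exy]]].
set T := @contraction _ e => cB.
have bl (B : {B | B \in contraction_vertices e}) : block e (val B) by exact: valP.
have nxy : ~~ nonbridge e x y by apply: contraction_edge_bridge xB1 yB2.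
case/negP: (nxy); rewrite /= exy /=.
have /connectP[p pp pl] := cB.
suff lift (B : {B | B \in contraction_vertices e}) u :
    path (del_edge B1 B2 T) B p -> u \in val B -> y \in val (last B p) ->
    connect (del_edge x y e) u y by apply: lift pp xB1 _; rewrite -pl.
elim: p B u {pp pl} => [|B' p IHp] B u /=.
  by move=> _ uB yB; apply: (block_connect eG de nxy (bl B)).
case/andP=> /andP[/andP[BB' /existsP[a /andP[aB /existsP[b /andP[bB' eab]]]]] nE] pp uB yl.
apply: connect_trans (IHp B' b pp bB' yl).
apply: connect_trans (block_connect eG de nxy (bl B) uB aB) _.
(* Vertices determine their blocks, so if ab were xy, the step of the contraction would be the
   excluded edge B1 B2. *)
apply: connect1; rewrite /= eab /=; apply: contraNneq nE => /eqP.
rewrite eq_set2 => /orP[] /andP[/eqP ax /eqP by_]; subst a b.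
  rewrite (val_inj (block_uniq de (bl B) (bl B1) aB xB1)).
  by rewrite (val_inj (block_uniq de (bl B') (bl B2) bB' yB2)).
rewrite (val_inj (block_uniq de (bl B) (bl B2) aB yB2)).
by rewrite (val_inj (block_uniq de (bl B') (bl B1) bB' xB1)) setUC.
Qed.

End CyclesAndBlocks.

(** Compares matchings over different vertex types. Injectivity is asked only at ends of edges, so
    [h] may take arbitrary values elsewhere. *)
Lemma matching_number_hom (V W : finType) (e : rel V) (f : rel W) (h : V -> W) :
    symmetric e -> (forall x y, e x y -> f (h x) (h y)) ->
    (forall x y u v, e x y -> e u v -> h x = h u -> x = u) ->
  matching_number e <= matching_number f.
Proof.
move=> es ef hI; have [M [mM <-]] := matching_number_witness e.
have /andP[/subsetP Me /trivIsetP tM] := mM.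
have hE x y : h @: [set x; y] = [set h x; h y] by rewrite imsetU !imset_set1.
have dis E F z w : E \in M -> F \in M -> z \in E -> w \in F -> h z = h w -> E = F.
  move=> EM FM zE wF hzw; apply/eqP; apply: contraT => neq.
  have [x [y [exy EE]]] := edgesP _ _ (Me _ EM).
  have [u [v [euv FE]]] := edgesP _ _ (Me _ FM).
  have [z' ez] : exists z', e z z'.
    by move: zE; rewrite EE => /set2P[] ->; [exists y | exists x; rewrite es].
  have [w' ew] : exists w', e w w'.
    by move: wF; rewrite FE => /set2P[] ->; [exists v | exists u; rewrite es].
  have zw := hI _ _ _ _ ez ew hzw.
  by have /pred0P/(_ z) := tM _ _ EM FM neq; rewrite /= zE zw wF.
rewrite -(card_in_imset (f := fun E : {set V} => h @: E) (D := M)); last first.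
  move=> E F EM FM hEF; have [x [y [exy EE]]] := edgesP _ _ (Me _ EM).
  have xE : x \in E by rewrite EE set21.
  have /imsetP[w wF hxw] : h x \in h @: F by rewrite -hEF imset_f.
  exact: dis xE wF hxw.
apply: matching_number_max; apply/andP; split.
  apply/subsetP => _ /imsetP[E EM ->]; have [x [y [exy ->]]] := edgesP _ _ (Me _ EM).
  by rewrite hE; apply/edgesP; exists (h x), (h y); split=> //; apply: ef.
apply/trivIsetP => _ _ /imsetP[E EM ->] /imsetP[F FM ->] neq.
apply/pred0P => z; apply/negP => /andP[/imsetP[x xE ->] /imsetP[y yF hxy]].
by case/eqP: neq; rewrite (dis E F x y).
Qed.

Local Open Scope ring_scope.
Local Open Scope sesquilinear_scope.

(** * Positive inertia of Hermitian matrices *)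

Section PositiveInertia.

Variable C : numClosedFieldType.

(** Used in two ways: as the orthogonal projection onto the coordinates in [S], and through its row
    space, the vectors supported on [S]. *)
Definition coord_mx n (S : {set 'I_n}) : 'M[C]_n :=
  diag_mx (\row_i (i \in S)%:R).

Lemma mul_coord_mx n (S : {set 'I_n}) (v : 'rV[C]_n) i :
  (v *m coord_mx S) 0 i = v 0 i * (i \in S)%:R.
Proof. by rewrite mul_mx_diag !mxE. Qed.

Lemma sub_coord_mxP n (S : {set 'I_n}) (v : 'rV[C]_n) :
  reflect (forall i, i \notin S -> v 0 i = 0) (v <= coord_mx S)%MS.
Proof.
apply: (iffP submxP) => [[w ->] i iS|v0].
  by rewrite mul_coord_mx (negbTE iS) mulr0.
exists v; apply/rowP => i; rewrite mul_coord_mx.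
by case: (boolP (i \in S)) => [_|/v0 ->]; rewrite ?mulr1 ?mul0r.
Qed.

(** The rank is at most |S| as a sum of |S| matrices of rank one; the same bound for the complement,
    together with the sum being the identity, gives the converse. *)
Lemma rank_coord_mx n (S : {set 'I_n}) : \rank (coord_mx S) = #|S|.
Proof.
have ub (T : {set 'I_n}) : (\rank (coord_mx T) <= #|T|)%N.
  have -> : coord_mx T = \sum_(i in T) delta_mx i i.
    apply/matrixP => i j; rewrite !mxE summxE.
    case: (boolP (i \in T)) => iT.
      rewrite (bigD1 i) //= mxE eqxx big1 ?addr0 /= 1?eq_sym ?mulrb //.
      by move=> k /andP[_ ki]; rewrite mxE eq_sym (negbTE ki).
    rewrite mul0rn big1 // => k kT; rewrite mxE.
    by case: eqP => // ik; rewrite ik kT in iT.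
  rewrite -sum1_card; elim/big_rec2: _ => [|i r M _ IH]; first by rewrite mxrank0.
  apply: leq_trans (mxrank_add _ _) _; apply: leq_add => //.
  by rewrite mxrank_delta.
apply/eqP; rewrite eqn_leq ub /=.
have e1 : coord_mx S + coord_mx (~: S) = 1%:M.
  apply/matrixP => i j; rewrite !mxE inE -mulrnDl.
  by case: (i \in S); rewrite ?addr0 ?add0r.
have := mxrank_add (coord_mx S) (coord_mx (~: S)).
rewrite e1 mxrank1 => h; have := ub (~: S); have := cardsC S.
rewrite card_ord => cS hu.
by rewrite -(leq_add2r #|~: S|) cS (leq_trans h) // leq_add2l.
Qed.

Definition hform n (A : 'M[C]_n) (v : 'rV[C]_n) : C := (v *m A *m v ^t*) 0 0.

Definition selfadjoint n (A : 'M[C]_n) : Prop := A ^t* = A.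

Lemma adj_mul m n p (A : 'M[C]_(m, n)) (B : 'M[C]_(n, p)) :
  (A *m B) ^t* = B ^t* *m A ^t*.
Proof. by rewrite trmx_mul map_mxM. Qed.

Lemma hform_mulmx m n (P : 'M[C]_(m, n)) (A : 'M[C]_n) v :
  hform (P *m A *m P ^t*) v = hform A (v *m P).
Proof. by rewrite /hform adj_mul !mulmxA. Qed.

Lemma hformD n (A B : 'M[C]_n) v : hform (A + B) v = hform A v + hform B v.
Proof. by rewrite /hform mulmxDr mulmxDl mxE. Qed.

Lemma hform_adj n (A : 'M[C]_n) v : hform (A ^t*) v = (hform A v)^*.
Proof.
transitivity (((v *m A *m v ^t*) ^t*) 0 0); last by rewrite [LHS]mxE [X in X^*]mxE.
by rewrite /hform !adj_mul trmxCK mulmxA.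
Qed.

(* [v -> v *m P ^t*] gives the coordinates in an eigenbasis. *)
Lemma hform_spectral n (P : 'M[C]_n) (d : 'rV[C]_n) v :
  hform (P ^t* *m diag_mx d *m P) v
  = \sum_i d 0 i * `|(v *m P ^t*) 0 i| ^+ 2.
Proof.
have := hform_mulmx (P ^t*) (diag_mx d) v; rewrite trmxCK => ->.
rewrite /hform mxE; apply: eq_bigr => i _.
by rewrite mul_mx_diag !mxE normCK mulrAC mulrC.
Qed.

(** The characteristic polynomial is invariant under conjugation, so its list of roots is a
    permutation of the diagonal of the spectral decomposition. *)
Lemma selfadjoint_spectral n (A : 'M[C]_n) : selfadjoint A ->
  exists (P : 'M[C]_n) (d : 'rV[C]_n),
    [/\ P \is unitarymx, A = P ^t* *m diag_mx d *m P,
        forall i, d 0 i \is Num.real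
      & positive_inertia A = #|[set i | 0 < d 0 i]|].
Proof.
move=> hA; exists (spectralmx A), (spectral_diag A).
have hAh : A \is hermsymmx.
  by apply/is_hermitianmxP; rewrite expr0 scale1r -{1}hA.
have AE := orthomx_spectralP (hermitian_normalmx hAh).
set P := spectralmx A in AE *; set d := spectral_diag A in AE *.
have PU : P \is unitarymx by exact: spectral_unitarymx.
have dR : d \is a realmx by exact: hermitian_spectral_diag_real.
split=> //; first by rewrite -(invmx_unitary PU) -AE.
  by move=> i; have /mxOverP := dR; apply.
have cE : char_poly A = \prod_(i < n) ('X - (d 0 i)%:P).
  transitivity (char_poly (diag_mx d)); last first.
    rewrite char_poly_trig ?diag_mx_is_trig //.
    by apply: eq_bigr => i _; rewrite mxE eqxx.
  have Pu : P \in unitmx by exact: unitarymx_unit.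
  rewrite /char_poly /char_poly_mx AE !map_mxM.
  set Q := map_mx polyC P; set Q' := map_mx polyC (invmx P).
  have QQ : Q' *m Q = 1%:M by rewrite -map_mxM mulVmx // map_mx1.
  set D := map_mx _ (diag_mx d).
  have -> : 'X%:M - Q' *m D *m Q = Q' *m ('X%:M - D) *m Q.
    by rewrite mulmxBr mulmxBl mul_mx_scalar -scalemxAl QQ scalemx1.
  by rewrite !det_mulmx mulrAC -det_mulmx QQ det1 mul1r.
rewrite /positive_inertia /eigenvalues.
case: (closed_field_poly_normal (char_poly A)) => r /= rE.
move: rE; rewrite (monicP (char_poly_monic A)) scale1r cE => rE.
have /prod_XsubC_eq pe : \prod_(x <- [seq d 0 i | i <- enum 'I_n]) ('X - x%:P)
   = \prod_(x <- r) ('X - x%:P) by rewrite -rE big_map big_enum.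
have /permP <- := pe.
rewrite count_map -size_filter cardE enumT /enum_mem; congr size.
by apply: eq_filter => i; rewrite !inE.
Qed.

(** [V] is spanned by the eigenvectors with positive eigenvalue, [N] by the others. On [N] the form
    is a sum of nonpositive terms; if it is also nonnegative, all terms vanish and the vector lies
    in the kernel. *)
Lemma inertia_spaces n (A : 'M[C]_n) : selfadjoint A ->
  exists V N : 'M[C]_n,
    [/\ (\rank V = positive_inertia A)%N /\ (V <= A)%MS,
        forall v, (v <= V)%MS -> v != 0 -> 0 < hform A v,
        (\rank N + positive_inertia A = n)%N,
        forall v, (v <= N)%MS -> hform A v <= 0
      & forall v, (v <= N)%MS -> 0 <= hform A v -> v *m A = 0].
Proof.
move=> /selfadjoint_spectral [P [d [PU AE dR ->]]].
set S := [set i | _].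
have Pu : P \in unitmx by exact: unitarymx_unit.
have Pf : row_free P by rewrite row_free_unit.
have PK : P *m P ^t* = 1%:M by exact/unitarymxP.
have PK' : P ^t* *m P = 1%:M by rewrite -(invmx_unitary PU) mulVmx.
have coordP T (v : 'rV_n) : (v <= coord_mx T *m P)%MS ->
    forall i, i \notin T -> (v *m P ^t*) 0 i = 0.
  case/submxP => w -> i iT; rewrite mulmxA -(mulmxA _ P) PK mulmx1.
  by rewrite mul_coord_mx (negbTE iT) mulr0.
have tle (v : 'rV_n) i : (v <= coord_mx (~: S) *m P)%MS ->
    d 0 i * `|(v *m P ^t*) 0 i| ^+ 2 <= 0.
  move=> vS; case: (boolP (i \in ~: S)) => [|/(coordP _ _ vS) ->]; last first.
    by rewrite normr0 expr0n mulr0.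
  by rewrite !inE -real_leNgt ?real0 // => d0; rewrite mulr_le0_ge0 ?exprn_ge0.
exists (coord_mx S *m P), (coord_mx (~: S) *m P); split.
- split; first by rewrite mxrankMfree // rank_coord_mx.
  (* Dividing by the eigenvalue puts an eigenvector of a nonzero eigenvalue into the row space of
     [A]. *)
  have -> : coord_mx S *m P
      = diag_mx (\row_i ((i \in S)%:R / d 0 i)) *m P *m A.
    rewrite AE !mulmxA -(mulmxA _ P) PK mulmx1 mulmx_diag.
    congr (diag_mx _ *m _); apply/rowP => i; rewrite !mxE inE.
    case: (boolP (0 < d 0 i)) => [d0|]; rewrite ?mul0r //.
    by rewrite mul1r mulVf // gt_eqF.
  exact: submxMl.
- move=> v vS v0; rewrite AE hform_spectral lt_def; apply/andP; split.
    apply: contra v0; rewrite psumr_eq0 => [/allP s0|i _]; last first.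
      case: (boolP (i \in S)) => [|/(coordP _ _ vS) ->]; last first.
        by rewrite normr0 expr0n mulr0.
      by rewrite inE => d0; rewrite mulr_ge0 ?exprn_ge0 // ltW.
    suff : v *m P ^t* == 0.
      by move/eqP/(congr1 (mulmx^~ P)); rewrite -mulmxA PK' mulmx1 mul0mx => ->.
    apply/eqP/rowP => i; rewrite [RHS]mxE.
    case: (boolP (i \in S)) => [|/(coordP _ _ vS) //].
    rewrite inE => d0; have := s0 i (mem_index_enum i).
    by rewrite /= mulf_eq0 gt_eqF //= expf_eq0 /= normr_eq0 => /eqP.
  apply: sumr_ge0 => i _.
  case: (boolP (i \in S)) => [|/(coordP _ _ vS) ->]; last first.
    by rewrite normr0 expr0n mulr0.
  by rewrite inE => d0; rewrite mulr_ge0 ?exprn_ge0 // ltW.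
- rewrite mxrankMfree // rank_coord_mx cardsCs setCK card_ord subnK //.
  by have := max_card [in S]; rewrite card_ord.
- by move=> v vS; rewrite AE hform_spectral sumr_le0 // => i _; apply: tle.
- move=> v vS; rewrite AE hform_spectral => h.
  have t0 i : d 0 i * `|(v *m P ^t*) 0 i| ^+ 2 = 0.
    apply/eqP; rewrite eq_le tle //=.
    apply: le_trans h _; rewrite (bigD1 i) //= gerDl.
    by apply: sumr_le0 => j _; apply: tle.
  suff e0 : v *m P ^t* *m diag_mx d = 0 by rewrite !mulmxA e0 mul0mx.
  apply/rowP => i; rewrite mul_mx_diag !mxE.
  have /eqP := t0 i; rewrite mulf_eq0 expf_eq0 /= normr_eq0 !mxE.
  by case/orP => /eqP ->; rewrite ?mulr0 ?mul0r.
Qed.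

Lemma capmx_eq0 m1 m2 n (V : 'M[C]_(m1, n)) (W : 'M[C]_(m2, n)) :
  (forall v : 'rV_n, (v <= V)%MS -> (v <= W)%MS -> v = 0) -> (V :&: W)%MS = 0.
Proof.
move=> h; apply/eqP; rewrite -submx0; apply/row_subP => i.
rewrite submx0; apply/eqP; apply: h; apply: submx_trans (row_sub _ _) _.
  exact: capmxSl.
exact: capmxSr.
Qed.

(** A vector common to [Q] and the nonpositive space has form 0, hence is in the kernel, hence is 0.
    Nonnegativity on [Q] is enough, so [Q] may contain isotropic vectors. *)
Lemma inertia_ge_rank m n (A : 'M[C]_n) (Q : 'M[C]_(m, n)) : selfadjoint A ->
    (forall v, (v <= Q)%MS -> 0 <= hform A v) ->
    (forall v : 'rV_n, (v <= Q)%MS -> v *m A = 0 -> v = 0) ->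
  (\rank Q <= positive_inertia A)%N.
Proof.
move=> /inertia_spaces [_ [N [_ _ rN _ N0]]] Q0 Qker.
have d0 : (Q :&: N)%MS = 0.
  by apply: capmx_eq0 => v vQ vN; apply: Qker => //; apply: N0 => //; apply: Q0.
have := rank_leq_col (Q + N)%MS.
by rewrite (mxrank_disjoint_sum d0) -[X in (_ <= X)%N]rN addnC leq_add2l.
Qed.

Lemma inertia_gt0_rank m n (A : 'M[C]_n) (Q : 'M[C]_(m, n)) : selfadjoint A ->
    (forall v, (v <= Q)%MS -> v != 0 -> 0 < hform A v) ->
  (\rank Q <= positive_inertia A)%N.
Proof.
move=> hA Qp; apply: inertia_ge_rank => // v vQ.
  have [->|v0] := eqVneq v 0; last by rewrite ltW // Qp.
  by rewrite /hform !mul0mx mxE.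
move=> vA; apply: contraTeq isT => v0.
by have := Qp _ vQ v0; rewrite /hform vA mul0mx mxE ltxx.
Qed.

Lemma inertia_le_corank m n (A : 'M[C]_n) (Q : 'M[C]_(m, n)) : selfadjoint A ->
    (forall v, (v <= Q)%MS -> hform A v <= 0) ->
  (positive_inertia A + \rank Q <= n)%N.
Proof.
move=> /inertia_spaces [V [_ [[rV _] Vp _ _ _]]] Q0.
have d0 : (V :&: Q)%MS = 0.
  apply: capmx_eq0 => v vV vQ; apply/eqP; apply: contraT => v0.
  by have := lt_le_trans (Vp v vV v0) (Q0 v vQ); rewrite ltxx.
by have := rank_leq_col (V + Q)%MS; rewrite (mxrank_disjoint_sum d0) rV.
Qed.

(** On the positive space of A + B cut with the nonpositive space of A, the form of B is positive,
    and the cut costs at most p(A) dimensions. *)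
Lemma inertiaD_le n (A B : 'M[C]_n) : selfadjoint A -> selfadjoint B ->
  (positive_inertia (A + B)%R <= positive_inertia A + positive_inertia B)%N.
Proof.
move=> hA hB; have hAB : selfadjoint (A + B) by rewrite /selfadjoint linearD /= map_mxD hA hB.
have [V [_ [[rV _] Vp _ _ _]]] := inertia_spaces hAB.
have [_ [N [_ _ rN N0 _]]] := inertia_spaces hA.
have h : (\rank (V :&: N)%MS <= positive_inertia B)%N.
  apply: inertia_gt0_rank => // v; rewrite sub_capmx => /andP[vV vN] v0.
  have := Vp v vV v0; rewrite hformD => /lt_le_trans; apply.
  by rewrite gerDr N0.
have := mxrank_sum_cap V N; have := rank_leq_col (V + N)%MS; lia.
Qed.

(** The positive spaces lie in the row spaces, so each is annihilated by the other matrix; their sum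
    is direct and the form of A + B on it splits. *)
Lemma inertiaD_ge n (A B : 'M[C]_n) : selfadjoint A -> selfadjoint B ->
    A *m B = 0 -> B *m A = 0 ->
  (positive_inertia A + positive_inertia B <= positive_inertia (A + B)%R)%N.
Proof.
move=> hA hB AB BA.
have hAB : selfadjoint (A + B) by rewrite /selfadjoint linearD /= map_mxD hA hB.
have [V [_ [[rV VA] Vp _ _ _]]] := inertia_spaces hA.
have [W [_ [[rW WB] Wp _ _ _]]] := inertia_spaces hB.
have VB (v : 'rV_n) : (v <= V)%MS -> v *m B = 0.
  by move=> /submx_trans/(_ VA)/submxP[D ->]; rewrite -mulmxA AB mulmx0.
have WA (v : 'rV_n) : (v <= W)%MS -> v *m A = 0.
  by move=> /submx_trans/(_ WB)/submxP[D ->]; rewrite -mulmxA BA mulmx0.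
have d0 : (V :&: W)%MS = 0.
  apply: capmx_eq0 => v vV vW; apply/eqP; apply: contraT => v0.
  by have := Vp v vV v0; rewrite /hform WA // mul0mx mxE ltxx.
rewrite -rV -rW -(mxrank_disjoint_sum d0).
apply: inertia_gt0_rank => // u /sub_addsmxP [[x y] /= ->].
set v := x *m V; set w := y *m W.
have vV : (v <= V)%MS by exact: submxMl.
have wW : (w <= W)%MS by exact: submxMl.
have Aw : A *m w ^t* = 0.
  by rewrite -{1}hA -adj_mul WA // trmx0 map_mx0.
have Bv : B *m v ^t* = 0.
  by rewrite -{1}hB -adj_mul VB // trmx0 map_mx0.
have -> : hform (A + B) (v + w) = hform A v + hform B w.
  rewrite /hform; have -> : (v + w) ^t* = v ^t* + w ^t* by rewrite linearD /= map_mxD.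
  have -> : (v + w) *m (A + B) = v *m A + w *m B.
    by rewrite mulmxDl !mulmxDr (VB _ vV) (WA _ wW) addr0 add0r.
  rewrite mulmxDl !mulmxDr -(mulmxA v A (w ^t*)) Aw.
  by rewrite -(mulmxA w B (v ^t*)) Bv !mulmx0 addr0 add0r mxE.
have h1 : 0 <= hform A v.
  have [->|v0] := eqVneq v 0; last by rewrite ltW // Vp.
  by rewrite /hform !mul0mx mxE.
have h2 : 0 <= hform B w.
  have [->|v0] := eqVneq w 0; last by rewrite ltW // Wp.
  by rewrite /hform !mul0mx mxE.
have [v0|v0] := eqVneq v 0.
  by rewrite v0 add0r => w0; rewrite ltr_wpDl ?Wp // -v0.
by move=> _; rewrite ltr_pwDl // Vp.
Qed.

End PositiveInertia.

(** * Gain graphs *)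

(* [lia] does not identify terms that differ by [reverse_coercion]. *)
Ltac rlia := unfold reverse_coercion in *; lia.

Section GainGraphs.

Variables (C : numClosedFieldType) (n : nat) (phi : 'I_n -> 'I_n -> C).
Implicit Types (e f g : rel 'I_n) (x y z u v w : 'I_n) (A : {set 'I_n}).

Definition gain_graph e := simple_graph e /\ unit_gain e phi.

Definition inertia e := positive_inertia (gain_adjacency e phi).

Lemma gain_graph_sub e f : simple_graph e -> subrel e f -> gain_graph f -> gain_graph e.
Proof. by move=> eG ef [fG fU]; split=> // i j /ef; apply: fU. Qed.

Lemma gain_graph_del A e : gain_graph e -> gain_graph (del A e).
Proof.
by move=> eG; apply: (gain_graph_sub _ (@del_sub _ A e) eG); apply: simple_del; case: eG.
Qed.

Lemma gain_conj e x y : gain_graph e -> e x y -> phi y x = (phi x y)^*.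
Proof.
move=> [eG eU] exy; have [nxy _] := eU _ _ exy.
have eyx : e y x by rewrite eG.1.
have [_ ->] := eU _ _ eyx.
by rewrite invC_norm nxy expr1n invr1 mul1r.
Qed.

Lemma selfadjoint_gain e : gain_graph e -> selfadjoint (gain_adjacency e phi).
Proof.
move=> eG; apply/matrixP => i j; rewrite !mxE eG.1.1.
by case: ifP => eij; rewrite ?rmorph0 // [RHS](gain_conj eG) // eG.1.1.
Qed.

Lemma eq_inertia e f : e =2 f -> inertia e = inertia f.
Proof.
by move=> ef; congr positive_inertia; apply/matrixP => i j; rewrite !mxE ef.
Qed.

Lemma coord_mx_adj A : (coord_mx C A) ^t* = coord_mx C A.
Proof.
apply/matrixP => i j; rewrite !mxE eq_sym.
by case: eqP => [->|_]; rewrite ?mulr1n ?mulr0n ?rmorph0 ?rmorph_nat.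
Qed.

Lemma gain_adjacency_del A e : gain_adjacency (del A e) phi
  = coord_mx C (~: A) *m gain_adjacency e phi *m (coord_mx C (~: A)) ^t*.
Proof.
rewrite coord_mx_adj; apply/matrixP => i j.
rewrite mul_mx_diag mul_diag_mx !mxE /= !inE.
by case: (e i j); case: (i \in A); case: (j \in A);
  rewrite /= ?mul0r ?mulr0 ?mulr1 ?mul1r.
Qed.

Lemma coord_mx_id A (v : 'rV[C]_n) : (v <= coord_mx C A)%MS -> v *m coord_mx C A = v.
Proof.
move=> /sub_coord_mxP vA; apply/rowP => i; rewrite mul_coord_mx.
by case: (boolP (i \in A)) => [_|/vA ->]; rewrite ?mulr1 ?mul0r.
Qed.

(** Cutting the positive space with the vectors supported off [A] costs at most |A| dimensions, and
    on those vectors both forms agree. *)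
Lemma inertia_del A e : gain_graph e -> (inertia e <= inertia (del A e) + #|A|)%N.
Proof.
move=> eG; have [V [_ [[rV _] Vp _ _ _]]] := inertia_spaces (selfadjoint_gain eG).
have h : (\rank (V :&: coord_mx C (~: A))%MS <= inertia (del A e))%N.
  apply: inertia_gt0_rank => [|v]; first exact/selfadjoint_gain/gain_graph_del.
  rewrite sub_capmx => /andP[vV vA] v0.
  by rewrite gain_adjacency_del hform_mulmx coord_mx_id // Vp.
have := mxrank_sum_cap V (coord_mx C (~: A)).
have := rank_leq_col (V + coord_mx C (~: A))%MS.
rewrite rank_coord_mx rV -/(inertia e); have := cardsC A; rewrite card_ord.
move: h; rlia.
Qed.

Lemma inertia_edgeless e : (forall x y, ~~ e x y) -> inertia e = 0%N.
Proof.
move=> e0; rewrite /inertia.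
have -> : gain_adjacency e phi = 0.
  by apply/matrixP => i j; rewrite !mxE (negbTE (e0 i j)).
have h0 : selfadjoint (0 : 'M[C]_n) by rewrite /selfadjoint trmx0 map_mx0.
have := @inertia_le_corank C n n 0 1%:M h0; rewrite mxrank1 => h.
suff : (positive_inertia (0 : 'M[C]_n) + n <= n)%N by lia.
by apply: h => v _; rewrite /hform mulmx0 mul0mx mxE.
Qed.

Lemma inertia_le e : gain_graph e -> (inertia e <= matching_number e + cyc e)%N.
Proof.
have [k] := ubnP #|edges e|; elim: k e => // k IHk e; rewrite ltnS => lek eG.
have step x y : e x y ->
    (inertia e <= (matching_number (del [set x] e) + cyc (del [set x] e)).+1)%N.
  move=> exy; apply: leq_trans (inertia_del [set x] eG) _.
  rewrite cards1 addn1 ltnS; apply: IHk; last exact: gain_graph_del.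
  by apply: leq_trans lek; apply: (card_edges_del eG.1 exy); rewrite inE.
case: (boolP [exists x, exists y, nonbridge e x y]) => [|nob].
  move=> /existsP[x /existsP[y nxy]]; have /andP[exy _] := nxy.
  apply: leq_trans (step x y exy) _; rewrite -addnS leq_add //.
    exact/matching_number_sub/del_sub.
  exact: cyc_del_nonbridge eG.1 nxy.
have fe : forest e.
  move=> x y; apply: contra nob => nxy; apply/existsP; exists x.
  by apply/existsP; exists y.
case: (boolP [exists x, exists y, e x y]) => [|noe].
  move=> /existsP[x /existsP[y exy]].
  have [u [w [euw wu]]] := forest_leaf eG.1 fe exy.
  apply: leq_trans (step u w euw) _; rewrite -addSn leq_add //.
    exact: matching_number_leaf euw wu eG.1.
  by apply: cyc_sub (@del_sub _ _ e); [apply: simple_del eG.1 | exact: eG.1].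
rewrite inertia_edgeless // => x y; apply: contra noe => exy.
by apply/existsP; exists x; apply/existsP; exists y.
Qed.

Lemma gain_adjacencyD e f g : (forall x y, e x y = f x y || g x y) ->
    (forall x y, f x y -> g x y -> False) ->
  gain_adjacency e phi = gain_adjacency f phi + gain_adjacency g phi.
Proof.
move=> efg dfg; apply/matrixP => i j; rewrite !mxE efg.
case: (boolP (f i j)) => fij; case: (boolP (g i j)) => gij;
  rewrite /= ?addr0 ?add0r //.
by case: (dfg i j).
Qed.

Lemma inertia_leD e f g : gain_graph f -> gain_graph g ->
    (forall x y, e x y = f x y || g x y) -> (forall x y, f x y -> g x y -> False) ->
  (inertia e <= inertia f + inertia g)%N.
Proof.
move=> fG gG efg dfg; rewrite /inertia (gain_adjacencyD efg dfg).
by apply: inertiaD_le; apply: selfadjoint_gain.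
Qed.

Lemma inertia_geD e f g : gain_graph f -> gain_graph g ->
    (forall x y, e x y = f x y || g x y) ->
    (forall x y z, f x y -> g x z -> False) ->
  (inertia f + inertia g <= inertia e)%N.
Proof.
move=> fG gG efg dfg; rewrite /inertia (gain_adjacencyD efg) => [|x y]; last exact: dfg.
apply: inertiaD_ge; try exact: selfadjoint_gain.
  apply/matrixP => i j; rewrite !mxE big1 // => k _; rewrite !mxE.
  case: ifP; case: ifP; rewrite ?mul0r ?mulr0 // => gkj fik.
  by case: (dfg k i j) => //; rewrite fG.1.1.
apply/matrixP => i j; rewrite !mxE big1 // => k _; rewrite !mxE.
case: ifP; case: ifP; rewrite ?mul0r ?mulr0 // => fkj gik.
by case: (dfg k j i) => //; rewrite gG.1.1.
Qed.

Definition extremal e := inertia e = (matching_number e + cyc e)%N.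

(** The bounds p(e) <= p(e - x) + 1 <= m(e - x) + c(e - x) + 1 <= m(e) + c(e) must all be
    equalities. *)
Lemma extremal_del_nonbridge e x y : gain_graph e -> extremal e -> nonbridge e x y ->
  [/\ extremal (del [set x] e), matching_number (del [set x] e) = matching_number e
    & cyc e = (cyc (del [set x] e)).+1].
Proof.
move=> eG ext nxy; have := inertia_del [set x] eG; rewrite cards1 ext.
have := inertia_le (gain_graph_del [set x] eG).
have := cyc_del_nonbridge eG.1 nxy.
have := matching_number_sub (@del_sub _ [set x] e).
by rewrite /extremal; split; rlia.
Qed.

Lemma extremal_disjoint e : gain_graph e -> extremal e -> disjoint_cycles e.
Proof.
move=> eG ext s t cs ct nst; apply: contraT => dst.
have [x [y [nxy]]] := shared_cycles eG.1 cs ct nst dst.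
by have [_ _ ->] := extremal_del_nonbridge eG ext nxy; rewrite ltnn.
Qed.

Lemma extremal_del_bridge e x y z : gain_graph e -> extremal e -> nonbridge e x y ->
    e x z -> ~~ nonbridge e x z ->
  extremal (del [set z] e)
  /\ matching_number e = (matching_number (del [set z] e)).+1.
Proof.
move=> eG ext nxy exz nxz; have [_ mx _] := extremal_del_nonbridge eG ext nxy.
have := bridge_end_essential eG.1 exz nxz mx.
have := inertia_del [set z] eG; rewrite cards1 ext.
have := inertia_le (gain_graph_del [set z] eG).
have := cyc_sub (simple_del [set z] eG.1) eG.1 (@del_sub _ [set z] e).
rewrite /extremal; rlia.
Qed.

Lemma del_del A (B : {set 'I_n}) e : del A (del B e) =2 del (B :|: A) e.
Proof.
move=> x y; rewrite /= !inE !negb_or.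
by case: (e x y); case: (x \in B); case: (y \in B); rewrite //= ?andbF.
Qed.

(** Vertices of cycles are deleted until no nonbridge is left; each deletion preserves equality,
    keeps m and lowers c by exactly one. *)
Lemma extremal_transversal e : gain_graph e -> extremal e ->
  exists X : {set 'I_n}, [/\ X \subset cycle_vertices e, #|X| = cyc e
    & matching_number (del X e) = matching_number e].
Proof.
have [k] := ubnP (cyc e); elim: k e => // k IHk e lek eG ext.
case: (boolP [exists x, exists y, nonbridge e x y]) => [|nob]; last first.
  exists set0; rewrite sub0set cards0; split=> //.
    have -> : cyc e = cyc (fun _ _ : 'I_n => false).
      apply: cyc_del_bridges => //; first exact: eG.1.
      move=> x y nxy; case/negP: nob; apply/existsP; exists x.
      by apply/existsP; exists y.
    by rewrite /cyc edges_rel0 n_comp_rel0 cards0 subnn.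
  by apply: eq_matching_number => x y; rewrite /= !inE !andbT.
move=> /existsP[x /existsP[y nxy]].
have [ext' me ce] := extremal_del_nonbridge eG ext nxy.
have lek' : (cyc (del [set x] e) < k)%N by move: lek; rewrite ce.
have [X [XO cX mX]] := IHk (del [set x] e) lek' (gain_graph_del [set x] eG) ext'.
have xX : x \notin X.
  apply/negP => /(subsetP XO)/(cycle_vertices_nonbridge (simple_del _ eG.1))[z].
  by rewrite /= inE eqxx andbF.
exists (x |: X); split.
- rewrite subUset sub1set; have [-> _] := nonbridge_cycle_vertices eG.1 nxy.
  apply: subset_trans XO _; apply/subsetP; exact: cycle_vertices_sub (@del_sub _ _ e).
- by rewrite cardsU1 xX cX ce.
- by rewrite -me -mX; apply: eq_matching_number => u v; rewrite del_del.
Qed.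

(** The set Z of the overview. *)
Definition bridge_neighbours e : {set 'I_n} :=
  [set z | [exists x in cycle_vertices e, e x z && ~~ nonbridge e x z]].

(** Deleting z lowers m, because z is joined to a cycle by a bridge; if z were on a cycle itself,
    its deletion would keep m. *)
Lemma bridge_neighbours_out e z : gain_graph e -> extremal e ->
  z \in bridge_neighbours e -> z \notin cycle_vertices e.
Proof.
move=> eG ext; rewrite inE => /existsP[x /and3P[xO exz nxz]].
have [y nxy] := cycle_vertices_nonbridge eG.1 xO.
have [_ mz] := extremal_del_bridge eG ext nxy exz nxz.
apply/negP => /(cycle_vertices_nonbridge eG.1)[w nzw].
have [_ + _] := extremal_del_nonbridge eG ext nzw; rlia.
Qed.

(** Stated for all subsets of Z so that the vertices can be deleted one by one: none lies on a
    cycle, so all cycles, and the bridges from them to the remaining vertices of Z, survive. *)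
Lemma extremal_del_bridge_neighbours e A : gain_graph e -> extremal e ->
    A \subset bridge_neighbours e ->
  extremal (del A e) /\ matching_number e = (#|A| + matching_number (del A e))%N.
Proof.
move=> eG ext; have [k] := ubnP #|A|; elim: k A => // k IHk A lek AZ.
have [->|[z zA]] := set_0Vmem A.
  have e0 : del set0 e =2 e by move=> x y; rewrite /= !inE !andbT.
  by rewrite /extremal (eq_inertia e0) (eq_cyc e0) (eq_matching_number e0) cards0.
have cA : #|A| = (#|A :\ z|).+1 by rewrite (cardsD1 z) zA.
have lek' : (#|A :\ z| < k)%N by move: lek; rewrite cA.
have [ext' mA] := IHk (A :\ z) lek' (subset_trans (subsetDl _ _) AZ).
have AO x : x \in cycle_vertices e -> x \notin A.
  by apply: contraL => /(subsetP AZ); apply: bridge_neighbours_out.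
have := subsetP AZ z zA; rewrite inE => /existsP[x /and3P[xO exz nxz]].
have [y nxy] := cycle_vertices_nonbridge eG.1 xO.
have eG' := gain_graph_del (A :\ z) eG.
have nxy' : nonbridge (del (A :\ z) e) x y.
  apply: nonbridge_del nxy; first exact: eG.1.
  by move=> u /AO; rewrite inE => /negbTE ->; rewrite andbF.
have exz' : del (A :\ z) e x z.
  by rewrite /= exz !inE eqxx (negbTE (AO _ xO)) andbF.
have nxz' : ~~ nonbridge (del (A :\ z) e) x z.
  by apply: contra nxz; apply: nonbridge_sub; apply: del_sub.
have [ext2 m2] := extremal_del_bridge eG' ext' nxy' exz' nxz'.
have e2 : del [set z] (del (A :\ z) e) =2 del A e.
  by move=> u v; rewrite del_del setUC setD1K.
rewrite /extremal -(eq_inertia e2) -(eq_cyc e2) -(eq_matching_number e2).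
by split=> //; rewrite mA m2 cA addnS.
Qed.

End GainGraphs.

(** * Positive inertia of a single cycle *)

Lemma next_nth_default (T : eqType) (x0 : T) (p : seq T) (s := x0 :: p) i :
  uniq s -> (i < size s)%N -> next s (nth x0 s i) = nth x0 s i.+1.
Proof. by move=> us lti; rewrite next_nth mem_nth // index_uniq. Qed.

Lemma next_next_neq (T : eqType) (s : seq T) x : uniq s -> (3 <= size s)%N ->
  x \in s -> next s (next s x) != x.
Proof.
move=> us s3 xs; have [i p pE] := rot_to xs.
rewrite -!(next_rot i us) pE.
have : uniq (x :: p) by rewrite -pE rot_uniq.
have : (3 <= size (x :: p))%N by rewrite -pE size_rot.
case: p {pE} => [|y [|z p]] //= _; rewrite !inE !negb_or eqxx.
case/and3P => /and3P[xy xz _] _ _.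
by rewrite (eq_sym y) (negbTE xy) eqxx eq_sym.
Qed.

Section CycleInertia.

Variables (C : numClosedFieldType) (n : nat) (phi : 'I_n -> 'I_n -> C).
Variables (f : rel 'I_n) (x0 : 'I_n) (p : seq 'I_n).
Let s := x0 :: p.
Hypotheses (fG : gain_graph phi f) (cs : is_cycle f s).
Hypothesis fs : forall u v, f u v -> [set u; v] \in cycle_edges s.

(** The default value of [nth] closes the cycle: [x (size s)] is again [x0]. *)
Let x i := nth x0 s i.
Let a i := phi (x i) (x i.+1).

Let us : uniq s. Proof. by have /is_cycleP[] := cs. Qed.
Let s3 : (3 <= size s)%N. Proof. by have /is_cycleP[] := cs. Qed.

Let next_x i : (i < size s)%N -> next s (x i) = x i.+1.
Proof. exact: next_nth_default. Qed.

Let f_next u : u \in s -> f u (next s u).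
Proof. by have /is_cycleP[_ _] := cs; apply. Qed.

Let f_cases u v : f u v -> (u \in s) && (v == next s u) || (v \in s) && (u == next s v).
Proof.
move=> /fs /imsetP[z zs /eqP]; rewrite eq_set2.
by case/orP => /andP[/eqP -> /eqP ->]; rewrite zs eqxx ?orbT.
Qed.

(** The adjacency matrix is the sum of the matrix of forward edges and its adjoint; the two do not
    overlap, because the length is at least 3. *)
Lemma hform_cycle (v : 'rV[C]_n) (t := fun i => v 0 (x i) * a i * (v 0 (x i.+1))^*) :
  hform (gain_adjacency f phi) v
  = \sum_(i < size s) t i + (\sum_(i < size s) t i)^*.
Proof.
pose A1 : 'M[C]_n := \matrix_(u, w) if (u \in s) && (w == next s u) then phi u w else 0.
have AE : gain_adjacency f phi = A1 + A1 ^t*.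
  apply/matrixP => u w; rewrite !mxE.
  case: (boolP (f u w)) => fuw; last first.
    case: ifP => [/andP[us' /eqP wE]|_]; first by rewrite wE f_next in fuw.
    case: ifP => [/andP[ws' /eqP uE]|_]; last by rewrite rmorph0 addr0.
    by rewrite uE fG.1.1 f_next in fuw.
  have := f_cases fuw; case: ifP => [/andP[us' /eqP wE]|_ /= ->].
    rewrite wE [X in _ && X](_ : _ = false) ?andbF ?rmorph0 ?addr0 //.
    by rewrite eq_sym; apply/negbTE/next_next_neq.
  by rewrite add0r (gain_conj fG fuw) conjCK.
have A1E : hform A1 v = \sum_(i < size s) t i.
  rewrite /hform mxE; under eq_bigr => w _ do rewrite mxE big_distrl /=.
  rewrite exchange_big /=.
  transitivity (\sum_(u <- s) v 0 u * phi u (next s u) * (v 0 (next s u))^*).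
    rewrite [RHS](eq_big_seq _ (fun _ _ => erefl _)).
    rewrite [RHS]big_uniq //= [LHS](bigID (fun u => u \in s)) /=.
    rewrite [X in _ + X]big1 ?addr0 => [|u nus]; last first.
      by rewrite big1 // => w _; rewrite !mxE (negbTE nus) mulr0 mul0r.
    apply: eq_bigr => u us'; rewrite (bigD1 (next s u)) //= !mxE us' eqxx.
    by rewrite big1 ?addr0 // => w wu; rewrite !mxE (negbTE wu) andbF mulr0 mul0r.
  rewrite (big_nth x0) big_mkord; apply: eq_bigr => i _.
  by rewrite /t /a /x -next_nth_default.
by rewrite AE hformD hform_adj A1E.
Qed.

(** The vertices at even positions meet every edge, so their deletion leaves no edges. *)
Lemma inertia_even_cycle : ~~ odd (size s) -> (inertia phi f <= (size s)./2)%N.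
Proof.
move=> evs; pose A := [set x (2 * j)%N | j : 'I_(size s)./2].
have cA : (#|A| <= (size s)./2)%N.
  by apply: leq_trans (leq_imset_card _ _) _; rewrite card_ord.
apply: leq_trans (inertia_del A fG) _; rewrite inertia_edgeless // => u w.
apply/negP => /and3P[fuw uA wA].
have key z : z \in s -> (z \in A) || (next s z \in A).
  move=> zs; have lti : (index z s < size s)%N by rewrite index_mem.
  have zE : z = x (index z s) by rewrite /x nth_index.
  rewrite {2}zE (next_x lti) {1}zE; move: (index z s) lti => i lti.
  have se := odd_double_half (size s); rewrite (negbTE evs) add0n in se.
  have ie := odd_double_half i; case: (boolP (odd i)) ie => oi ie.
    apply/orP; right; have [li|gi] := ltnP i.+1 (size s).
      have lt2 : (i./2.+1 < (size s)./2)%N by lia.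
      apply/imsetP; exists (Ordinal lt2) => //=; congr x; lia.
    (* The last position is odd, and its successor is [x0], at the even position 0. *)
    have lt2 : (0 < (size s)./2)%N by lia.
    apply/imsetP; exists (Ordinal lt2) => //=.
    by rewrite /x nth_default.
  apply/orP; left; have lt2 : (i./2 < (size s)./2)%N by lia.
  apply/imsetP; exists (Ordinal lt2) => //=; congr x; lia.
case/orP: (f_cases fuw) => /andP[zs /eqP wE].
  by have := key _ zs; rewrite -wE (negbTE uA) (negbTE wA).
by have := key _ zs; rewrite -wE (negbTE uA) (negbTE wA).
Qed.

Variable k : nat.
Hypothesis size_s : size s = k.*2.+1.

Let sgn_gain := (-1) ^+ k * cycle_gain phi s.

(* The entries at even positions of a vector that is 1 at [x 0] and
   orthogonal to the coordinate vectors at the odd positions. *)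
Fixpoint even_entry (j : nat) : C :=
  if j is i.+1 then - even_entry i * a i.*2 * a i.*2.+1 else 1.

Let aK i : (i < size s)%N -> a i * (a i)^* = 1.
Proof.
move=> lti; have fi : f (x i) (x i.+1) by rewrite -next_x // f_next ?mem_nth.
by rewrite -normCK (fG.2 _ _ fi).1 expr1n.
Qed.

Lemma even_entry_last : even_entry k * a k.*2 = sgn_gain.
Proof.
have evE j : even_entry j = (-1) ^+ j * \prod_(i < j.*2) a i.
  elim: j => [|j IHj]; first by rewrite big_ord0 expr0 mulr1.
  rewrite doubleS !big_ord_recr /= IHj exprS; ring.
rewrite evE /sgn_gain /cycle_gain (big_nth x0) big_mkord size_s big_ord_recr /=.
rewrite -mulrA; congr (_ * (_ * _)).
  apply: eq_bigr => i _; rewrite /a /x -next_nth_default //.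
  by rewrite -/s size_s; have := ltn_ord i; lia.
by rewrite /a /x -next_nth_default // -/s size_s.
Qed.

(** Column j is the condition that the entry at position 2j+2 equals [even_entry j.+1] times the
    entry at [x0]. These are k conditions, and the odd positions remain free. *)
Definition even_constraints : 'M[C]_(n, k) :=
  \matrix_(u, j) ((u == x j.+1.*2)%:R - (u == x0)%:R * even_entry j.+1).

Let Q := kermx even_constraints.

Let rank_Q : (n <= \rank Q + k)%N.
Proof. by rewrite mxrank_ker; have := rank_leq_col even_constraints; lia. Qed.

Let Q_even (v : 'rV[C]_n) j : (v <= Q)%MS -> (j <= k)%N ->
  v 0 (x j.*2) = v 0 x0 * even_entry j.
Proof.
case: j => [|j] vQ ltj; first by rewrite mulr1.
have /sub_kermxP/rowP/(_ (Ordinal ltj)) := vQ; rewrite !mxE => vE.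
apply/eqP; rewrite -subr_eq0; apply/eqP; apply: etrans vE.
under [RHS]eq_bigr => u _ do rewrite !mxE mulrBr mulrA.
rewrite sumrB /=; congr (_ - _).
  rewrite (bigD1 (x j.+1.*2)) //= eqxx mulr1 big1 ?addr0 // => u ux.
  by rewrite (negbTE ux) mulr0.
rewrite (bigD1 x0) //= eqxx mulr1 big1 ?addr0 // => u ux.
by rewrite (negbTE ux) mulr0 mul0r.
Qed.

(* On Q the edges at the odd positions cancel in pairs, and only the edge from
   the last vertex back to x0 contributes. *)
Let hform_Q (v : 'rV[C]_n) : (v <= Q)%MS ->
  hform (gain_adjacency f phi) v = `|v 0 x0| ^+ 2 * (sgn_gain + sgn_gain^*).
Proof.
move=> vQ; rewrite hform_cycle size_s big_ord_recr /=.
pose t i := v 0 (x i) * a i * (v 0 (x i.+1))^*.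
(* Position 2k+1 is past the end of the list, so the closing edge returns to [x0]. *)
have -> : v 0 (x k.*2) * a k.*2 * (v 0 (x k.*2.+1))^* = `|v 0 x0| ^+ 2 * sgn_gain.
  rewrite (Q_even vQ) // /x nth_default ?size_s // -even_entry_last normCK; ring.
suff T0 j : (j <= k)%N -> let T := \sum_(i < j.*2) t i in T + T^* = 0.
  rewrite rmorphD /= addrACA (T0 k (leqnn k)) add0r rmorphM /= mulrDr.
  by congr (_ + _ * _); rewrite rmorphXn /= conj_normC.
elim: j => [|j IHj] ltj /=; first by rewrite big_ord0 rmorph0 addr0.
rewrite doubleS !big_ord_recr /= !rmorphD /=.
set T1 := \sum_(i < _) _ in IHj *; set t1 := t j.*2; set t2 := t j.*2.+1.
have t12 : t2^* = - t1.
  rewrite /t2 /t1 /t !rmorphM /= conjCK -doubleS (Q_even vQ ltj) (Q_even vQ (ltnW ltj)) /=.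
  have lt1 : (j.*2.+1 < size s)%N by rewrite size_s; lia.
  have := aK lt1; set b := a j.*2.+1; set c := a j.*2 => bK.
  transitivity (- (b * b^*) * (v 0 (x j.*2.+1))^* * (v 0 x0 * even_entry j * c)).
    ring.
  by rewrite bK; ring.
have t21 : t1^* = - t2 by rewrite -[t2]conjCK t12 rmorphN opprK.
by rewrite t12 t21 -[RHS](IHj (ltnW ltj)); ring.
Qed.

Let sgn_gainE : sgn_gain + sgn_gain^* = 2 * 'Re sgn_gain.
Proof. by rewrite ReE mulrC mulfVK // pnatr_eq0. Qed.

Lemma inertia_odd_cycle_le : 'Re sgn_gain <= 0 -> (inertia phi f <= k)%N.
Proof.
move=> g0; have := inertia_le_corank (selfadjoint_gain fG) (Q := Q).
move=> h; have {}h : (inertia phi f + \rank Q <= n)%N.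
  apply: h => v vQ; rewrite hform_Q // sgn_gainE mulr_ge0_le0 ?exprn_ge0 //.
  by rewrite mulr_ge0_le0 // ler0n.
have := rank_Q; move: h; rlia.
Qed.

(** Among the vectors supported on the cycle, the conditions leave dimension at least (2k+1) - k =
    k+1. The form on them is a positive multiple of the squared modulus of the entry at [x0], so a
    kernel vector vanishes at all even positions; the kernel equations then remove the odd ones. *)
Lemma inertia_odd_cycle_gt : 0 < 'Re sgn_gain -> (k < inertia phi f)%N.
Proof.
move=> g0; have c0 : 0 < sgn_gain + sgn_gain^* by rewrite sgn_gainE mulr_gt0 ?ltr0n.
pose S := [set u in s]; have cS : #|S| = k.*2.+1.
  by rewrite cardsE -size_s; apply/card_uniqP.
pose Q' := (Q :&: coord_mx C S)%MS.
have rQ' : (k < \rank Q')%N.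
  have := mxrank_sum_cap Q (coord_mx C S); rewrite rank_coord_mx cS.
  have := rank_leq_col (Q + coord_mx C S)%MS; have := rank_Q; rewrite -/Q'; lia.
apply: leq_trans rQ' _; apply: inertia_ge_rank (selfadjoint_gain fG) _ _ => v.
  by rewrite sub_capmx => /andP[vQ _]; rewrite hform_Q // mulr_ge0 ?exprn_ge0 // ltW.
rewrite sub_capmx => /andP[vQ /sub_coord_mxP vS] vA.
have v00 : v 0 x0 = 0.
  have := hform_Q vQ; rewrite /hform vA mul0mx mxE => /esym/eqP.
  by rewrite mulf_eq0 (gt_eqF c0) orbF expf_eq0 /= normr_eq0 => /eqP.
have ev j : (j <= k)%N -> v 0 (x j.*2) = 0.
  by move=> lej; rewrite (Q_even vQ lej) v00 mul0r.
(* The equation at position 2j involves only positions 2j-1 and 2j+1. For j = 0 the other neighbour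
   is position 2k, which is even, and this starts the induction. *)
have od j : (j < k)%N -> v 0 (x j.*2.+1) = 0.
  have [m] := ubnP j; elim: m j => // m IHm j ltm ltj.
  have lt1 : (j.*2 < size s)%N by rewrite size_s; lia.
  have lt2 : (j.*2.+1 < size s)%N by rewrite size_s; lia.
  have fj : f (x j.*2.+1) (x j.*2) by rewrite fG.1.1 -next_x // f_next ?mem_nth.
  have /rowP/(_ (x j.*2)) := vA; rewrite !mxE (bigD1 (x j.*2.+1)) //= mxE fj.
  rewrite big1 ?addr0 => [/eqP|u uj].
    rewrite mulf_eq0 => /orP[/eqP // |/eqP phi0].
    have [+ _] := fG.2 _ _ fj; rewrite phi0 normr0 => /eqP.
    by rewrite eq_sym oner_eq0.
  rewrite mxE; case: ifP => [fu|_]; last by rewrite mulr0.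
  have [/andP[us' /eqP nu]|] := orP (f_cases fu); last first.
    by rewrite next_x // (negbTE uj) andbF.
  have uE : x (index u s) = u by rewrite /x nth_index.
  have lti : (index u s < size s)%N by rewrite index_mem.
  rewrite -uE next_x // in nu; rewrite -uE.
  move: (index u s) lti nu => i lti nu.
  have [lti1|gei1] := ltnP i.+1 (size s).
    have /eqP := nu; rewrite nth_uniq // => /eqP jE.
    have -> : i = j.-1.*2.+1 by lia.
    by rewrite IHm ?mul0r //; lia.
  have -> : i = k.*2 by move: lti gei1; rewrite size_s; lia.
  by rewrite ev // mul0r.
apply/rowP => u; rewrite mxE; case: (boolP (u \in S)) => [|/vS //].
rewrite inE => us'; have uE : x (index u s) = u by rewrite /x nth_index.
have lti : (index u s < size s)%N by rewrite index_mem.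
rewrite -uE; move: (index u s) lti; rewrite size_s => i lti.
have ie := odd_double_half i; case: (boolP (odd i)) ie => oi ie.
  by have -> : i = i./2.*2.+1 by []; apply: od; lia.
by have -> : i = i./2.*2 by []; apply: ev; lia.
Qed.

End CycleInertia.

(** A single cycle has m = floor(q/2) and c = 1, so Type C is the case p = m + c for it. *)
Lemma typeC_inertia (C : numClosedFieldType) n (phi : 'I_n -> 'I_n -> C)
    (f : rel 'I_n) (s : seq 'I_n) : gain_graph phi f -> is_cycle f s ->
    (forall u v, f u v -> [set u; v] \in cycle_edges s) ->
  typeC phi s <-> ((size s)./2 < inertia phi f)%N.
Proof.
move=> fG cs; have /is_cycleP[s3 _ _] := cs.
case: s s3 cs => // x0 p _; set s := x0 :: p => cs fs.
have [os|es] := boolP (odd (size s)); last first.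
  split=> [[]|]; first by rewrite (negbTE es).
  by rewrite ltnNge (inertia_even_cycle fG cs fs es).
have size_s : size s = (size s)./2.*2.+1 by rewrite -[LHS]odd_double_half os.
have half : (size s).-1./2 = (size s)./2 by rewrite size_s /= half_double uphalf_double.
rewrite /typeC half; split=> [[_]|lt]; first exact: inertia_odd_cycle_gt.
split=> //; rewrite real_ltNge ?real0 ?Creal_Re //; apply/negP => le0.
by move: lt; rewrite ltnNge (inertia_odd_cycle_le fG cs fs size_s).
Qed.

Lemma matching_number_induced (V : finType) (e : rel V) (A : {set V}) :
  symmetric e -> matching_number (@induced _ e A) = matching_number (del (~: A) e).
Proof.
move=> es; apply/eqP; rewrite eqn_leq; apply/andP; split.
  apply: (matching_number_hom (h := val)) => [x y|x y exy|x y u v _ _ /val_inj //].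
    by rewrite /induced /= es.
  move: exy; rewrite /induced /= => ->.
  by rewrite !inE !negbK (valP x) (valP y).
have ds : symmetric (del (~: A) e).
  by move=> x y; rewrite /= es [X in _ && X]andbC.
(* An element of [A] is needed as the default value of [insubd]. *)
case: (set_0Vmem A) => [A0|[a aA]].
  suff : (matching_number (del (~: A) e) <= #|@set0 V|)%N.
    by rewrite cards0 leqn0 => /eqP ->.
  by apply: matching_number_hit => x y; rewrite /= A0 !inE andbF.
apply: (matching_number_hom (h := fun x => insubd (exist _ a aA : {x | x \in A}) x)) => //.
  move=> x y /= /and3P[exy]; rewrite !inE !negbK => xA yA.
  by rewrite /induced /= !insubdK.
move=> x y u v /= /and3P[_ + _] /and3P[_ + _]; rewrite !inE !negbK => xA uA.
by move/(congr1 val); rewrite !insubdK.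
Qed.

Section Nonbridge.

Variable V : finType.
Implicit Types (e : rel V) (x y : V).

Lemma cyc_nonbridge e : simple_graph e -> cyc (nonbridge e) = cyc e.
Proof.
move=> eG; apply/esym/cyc_del_bridges => //; first exact: simple_nonbridge.
by move=> x y /andP[].
Qed.

(** A cycle consists of nonbridges, so it survives in the subgraph of nonbridges. *)
Lemma nonbridge_idem e : simple_graph e -> subrel (nonbridge e) (nonbridge (nonbridge e)).
Proof.
move=> eG x y /(nonbridge_cycle eG)[s cs xys].
apply: (cycle_edge_nonbridge (simple_nonbridge eG) _ xys).
have /is_cycleP[s3 us _] := cs; apply/is_cycleP; split=> // z zs.
exact: cycle_nonbridge.
Qed.

Lemma nonbridge_subrel e : subrel (nonbridge e) e.
Proof. by move=> x y /andP[]. Qed.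

Lemma block_of e x : exists2 B, block e B & x \in B.
Proof.
case: (boolP (x \in cycle_vertices e)) => [/cycle_verticesP[s cs xs]|xO].
  by exists [set z in s]; rewrite ?inE //; apply/blockP; left; exists s.
by exists [set x]; rewrite ?inE //; apply/blockP; right; exists x.
Qed.

Lemma block_set1 e B x : block e B -> x \in B -> x \notin cycle_vertices e -> B = [set x].
Proof.
case/blockP => [[s cs ->]|[y _ ->]]; rewrite !inE; last by move=> /eqP ->.
by move=> xs /negP[]; apply/cycle_verticesP; exists s.
Qed.

End Nonbridge.

(** * Graphs with p = m + c *)

Section Extremal.

Variables (C : numClosedFieldType) (n : nat) (phi : 'I_n -> 'I_n -> C).
Implicit Types (e f g : rel 'I_n) (x y z u v w : 'I_n) (A : {set 'I_n}).

(** Once Z is deleted, the graph e1 splits into the cycle f and a rest e2. Then p(f) + p(e2) >=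
    p(e1) = m(e1) + c(e1) >= m(f) + m(e2) + c(e2) + 1, and p(e2) <= m(e2) + c(e2) leaves p(f) > m(f)
    >= floor(q/2). *)
Lemma extremal_typeC e s : gain_graph phi e -> extremal phi e -> is_cycle e s ->
  typeC phi s.
Proof.
move=> eG ext cs; have de := extremal_disjoint eG ext.
have [ext1 _] := extremal_del_bridge_neighbours eG ext (subxx _).
set e1 := del _ e in ext1; have e1G : gain_graph phi e1 by exact: gain_graph_del.
pose f u v := [set u; v] \in cycle_edges s.
have sO u : u \in s -> u \in cycle_vertices e.
  by move=> us; apply/cycle_verticesP; exists s.
have sZ u : u \in s -> u \notin bridge_neighbours e.
  by move=> /sO; apply: contraL; apply: bridge_neighbours_out ext.
have cs1 : is_cycle e1 s by apply: (is_cycle_del _ cs).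
have fe : subrel f e1.
  by move=> u v; apply: (cycle_edge_rel _ cs1); exact: e1G.1.1.
have fG : gain_graph phi f.
  apply: (gain_graph_sub _ fe e1G); split=> [u v|u]; first by rewrite /f setUC.
  by apply/negP => /fe; rewrite e1G.1.2.
have cf : is_cycle f s.
  have /is_cycleP[s3 us _] := cs; apply/is_cycleP; split=> // u us'.
  exact: mem_cycle_edges.
apply/(typeC_inertia fG cf) => //.
pose S := [set u in s]; pose e2 := del S e1.
(* An edge at s that is not an edge of s is a bridge, so its other end lies in Z and has been
   deleted. *)
have close u v : e1 u v -> u \in s -> f u v.
  move=> e1uv us; apply: (nonbridge_cycle_edge eG.1 de cs us).
  have /and3P[euv _ vZ] := e1uv; apply: contraNT vZ => nuv.
  by rewrite inE; apply/existsP; exists u; rewrite sO // euv.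
have le1 : (inertia phi e1 <= inertia phi f + inertia phi e2)%N.
  apply: inertia_leD => //; first exact: gain_graph_del.
    move=> u v; apply/idP/orP => [e1uv|[/fe //|/del_sub //]].
    case: (boolP (u \in s)) => us; first by left; apply: close.
    case: (boolP (v \in s)) => vs.
      by left; rewrite /f setUC; apply: close => //; rewrite e1G.1.1.
    by right; apply/and3P; split; rewrite ?inE.
  by move=> u v /cycle_edges_mem/andP[us _] /and3P[_]; rewrite inE us.
have le2 := inertia_le (gain_graph_del S e1G).
have le3 : (cyc e2 < cyc e1)%N.
  have [x xs] : exists x, x \in s.
    by case/is_cycleP: cs => s3 _ _; case: (s) s3 => // x p _; exists x; rewrite mem_head.
  apply: leq_ltn_trans (cyc_del_nonbridge e1G.1 (cycle_nonbridge e1G.1 cs1 xs)).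
  apply: cyc_sub; [exact: simple_del e1G.1 | exact: simple_del e1G.1|].
  by apply: del_subset; apply/subsetP => z; rewrite !inE => /eqP ->.
have le4 : (matching_number f + matching_number e2 <= matching_number e1)%N.
  apply: matching_number_disjoint => //.
  - by have [[]] := gain_graph_del S e1G.
  - exact: del_sub.
  - by move=> u v w /cycle_edges_mem/andP[us _] /and3P[_]; rewrite inE us.
  - exact: fG.1.1.
have le5 := matching_number_cycle fG.1 cf.
move: ext1 le1 le2; rewrite /extremal -/e2; rlia.
Qed.

(** A maximum matching M that avoids the transversal X is split into its nonbridges M1 and its
    bridges M2. Counting shows that M1 covers all of O outside X; hence M2 avoids O, and its size is
    at least |Z| + m(e - O - Z). *)
Lemma extremal_matching e (O := cycle_vertices e) (Z := bridge_neighbours e) :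
    gain_graph phi e -> extremal phi e ->
  (matching_number (del (O :|: Z) e) + #|Z| <= matching_number (del O e))%N.
Proof.
move=> eG ext; have de := extremal_disjoint eG ext.
have [eS _] := eG; have [X [XO cX mX]] := extremal_transversal eG ext.
have [_ mZ] := extremal_del_bridge_neighbours eG ext (subxx _).
pose H := nonbridge e; have HG : simple_graph H by exact: simple_nonbridge.
have HO x y : H x y -> x \in O /\ y \in O by exact: nonbridge_cycle_vertices.
have ZO x : x \in O -> x \notin Z.
  by apply: contraL; apply: bridge_neighbours_out ext.
have bridgeZ x y : e x y -> ~~ H x y -> x \in O -> y \in Z.
  by move=> exy nxy xO; rewrite inE; apply/existsP; exists x; rewrite exy xO.
have mH : (matching_number (del (O :|: Z) e) + matching_number H
           <= matching_number (del Z e))%N.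
  apply: matching_number_disjoint.
  - exact: HG.1.
  - by apply: del_subset; apply: subsetUr.
  - move=> x y Hxy; have [xO yO] := HO _ _ Hxy.
    by rewrite /= !ZO // (nonbridge_subrel Hxy).
  - move=> x y z /= /and3P[_ + _] /HO[xO _]; rewrite inE xO //.
  - by case: (simple_del (O :|: Z) eS).
have [M [mM cM]] := matching_number_witness (del X e); rewrite mX in cM.
have /andP[/subsetP Me /trivIsetP tM] := mM.
pose M1 := M :&: edges H; pose M2 := M :\: edges H.
have M12 : (#|M1| + #|M2| = matching_number e)%N by rewrite cardsID cM.
have mM1 : matching H M1.
  by apply: (matching_sub _ _ mM); rewrite ?subsetIl ?subsetIr.
have le1 := matching_number_max mM1.
pose g x y := e x y && ~~ H x y.
have M2e E : E \in M2 -> exists x y, [/\ E = [set x; y], g x y, x \notin X & y \notin X].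
  case/setDP => EM nH; have [x [y [/and3P[exy xX yX] EE]]] := edgesP _ _ (Me _ EM).
  exists x, y; split=> //; rewrite /g exy; apply: contra nH => Hxy.
  by apply/edgesP; exists x, y.
(* A bridge with one end in O has the other end in Z, so the bridges that avoid Z also avoid O. *)
have le2 : (#|M2| <= #|Z| + matching_number (del (O :|: Z) e))%N.
  have mM2 : matching g M2.
    apply: (matching_sub _ _ mM); first exact: subsetDl.
    apply/subsetP => E /M2e[x [y [-> gxy _ _]]].
    by apply/edgesP; exists x, y.
  apply: leq_trans (matching_number_max mM2) _.
  apply: leq_trans (matching_number_del Z g) _; rewrite addnC leq_add2l.
  apply: matching_number_sub => x y /= /and3P[/andP[exy nxy] xZ yZ].
  rewrite exy !in_setU !negb_or xZ yZ !andbT /=; apply/andP; split.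
    by apply: contra yZ; apply: bridgeZ.
  apply: contra xZ; apply: bridgeZ; first by rewrite eS.1.
  by rewrite /H (nonbridge_sym eS).
have cM1 := card_cover_matching HG mM1.
have M1sub : cover M1 \subset O :\: X.
  apply/subsetP => z /coverP[E /setIP[EM /edgesP[x [y [Hxy EE]]]] zE].
  have [xO yO] := HO _ _ Hxy; have [u [v [/and3P[_ uX vX] EE']]] := edgesP _ _ (Me _ EM).
  rewrite inE; apply/andP; split.
    by move: zE; rewrite EE' => /set2P[] ->.
  by move: zE; rewrite EE => /set2P[] ->.
have cO := card_cycle_vertices_le HG (disjoint_cycles_sub (@nonbridge_subrel _ e) de)
  (nonbridge_idem eS).
have OH : O \subset cycle_vertices H.
  apply/subsetP => z /(cycle_vertices_nonbridge eS)[y nzy].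
  by have [] := nonbridge_cycle_vertices HG (nonbridge_idem eS nzy).
have cO' := leq_trans (subset_leq_card OH) cO; rewrite cyc_nonbridge // -cX in cO'.
have cOX : #|O :\: X| = (#|O| - #|X|)%N by rewrite cardsD (setIidPr XO).
(* By [mZ], [mH], [M12] and [le2], |M1| >= m(H); by [cO'], |O| - |X| <= 2 m(H). Hence the cover of
   M1 is large enough to fill [O :\: X]. *)
have /eqP M1E : cover M1 == O :\: X.
  by rewrite eqEcard M1sub cOX cM1; move: mZ mH M12 le2 cO'; rewrite /Z /O /H; rlia.
have mM2 : matching (del O e) M2.
  apply: (matching_sub _ _ mM); first exact: subsetDl.
  apply/subsetP => E EM2; have [x [y [EE /andP[exy _] xX yX]]] := M2e E EM2.
  have out z : z \in E -> z \notin X -> z \notin O.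
    move=> zE zX; apply/negP => zO.
    have : z \in cover M1 by rewrite M1E inE zX.
    move=> /coverP[F FM1 zF]; have /setIP[FM FH] := FM1; have /setDP[EM EH] := EM2.
    have neq : E != F by apply: contraNneq EH => ->.
    by have /pred0P/(_ z) := tM E F EM FM neq; rewrite /= zE zF.
  apply/edgesP; exists x, y; split=> //=.
  by rewrite exy !out // EE ?set21 ?set22.
have le3 := matching_number_max mM2.
move: mZ mH le1 M12 le3; rewrite -/O -/Z -/H; rlia.
Qed.

(** For the upper bound, the singletons of Z are deleted from the contraction at a cost of at most
    |Z|; all remaining edges join singletons off O and Z. For the lower bound, G - O embeds through
    singletons. *)
Lemma extremal_contraction e : gain_graph phi e -> extremal phi e ->
  matching_number (@contraction _ e)
  = matching_number (@induced _ e (~: cycle_vertices e)).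
Proof.
move=> eG ext; have de := extremal_disjoint eG ext; have eS := eG.1.
set O := cycle_vertices e; set Z := bridge_neighbours e.
have mI : matching_number (@induced _ e (~: O)) = matching_number (del O e).
  by rewrite matching_number_induced ?setCK //; exact: eS.1.
set T := @contraction _ e; have TG : simple_graph T by exact: simple_contraction.
pose W := {B : {set 'I_n} | B \in contraction_vertices e}.
have bl (B : W) : block e (val B) by exact: valP.
apply/eqP; rewrite eqn_leq; apply/andP; split.
  rewrite mI; apply: leq_trans (extremal_matching eG ext); rewrite -/O -/Z.
  pose ZT := [set B : W | [exists z in Z, val B == [set z]]].
  have cZT : (#|ZT| <= #|Z|)%N.
    rewrite -(card_imset _ val_inj) -(card_imset Z set1_inj).
    apply/subset_leq_card/subsetP => _ /imsetP[B + ->].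
    by rewrite inE => /existsP[z /andP[zZ /eqP ->]]; apply: imset_f.
  apply: leq_trans (matching_number_del ZT T) _; apply: leq_add cZT.
  (* An edge of the contraction at a cycle comes from a bridge whose other end is in Z, so no such
     edge is left. *)
  have single (B B' : W) x y : T B B' -> B' \notin ZT -> x \in val B -> y \in val B' ->
      e x y -> x \notin O.
    move=> /andP[neq _] B'Z xB yB' exy; apply: contra B'Z => xO.
    have nxy := contraction_edge_bridge eS de (bl B) (bl B') neq xB yB'.
    have yZ : y \in Z by rewrite inE; apply/existsP; exists x; rewrite exy xO.
    rewrite inE; apply/existsP; exists y; rewrite yZ /=; apply/eqP.
    by apply: (block_set1 (bl B') yB'); apply: bridge_neighbours_out ext _.
  have sing (B B' : W) : del ZT T B B' -> exists x y,
      [/\ val B = [set x], val B' = [set y], e x y, x \notin O :|: Z & y \notin O :|: Z].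
    case/and3P => TBB BZ B'Z; have /andP[neq /existsP[x /andP[xB]]] := TBB.
    case/existsP=> y /andP[yB' exy].
    have xO := single B B' x y TBB B'Z xB yB' exy.
    have yO : y \notin O.
      by apply: (single B' B _ _ _ BZ yB' xB); [rewrite TG.1 | rewrite eS.1].
    have BE := block_set1 (bl B) xB xO; have BE' := block_set1 (bl B') yB' yO.
    exists x, y; split=> //; rewrite inE negb_or ?xO ?yO /=.
      by apply: contra BZ => xZ; rewrite inE; apply/existsP; exists x; rewrite xZ BE eqxx.
    by apply: contra B'Z => yZ; rewrite inE; apply/existsP; exists y; rewrite yZ BE' eqxx.
  pose h (B : W) := xchoose (block_neq0 (bl B)).
  have hE (B : W) x : val B = [set x] -> h B = x.
    by move=> BE; have := xchooseP (block_neq0 (bl B)); rewrite -/(h B) BE => /set1P.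
  apply: (matching_number_hom (h := h)).
  - by case: (simple_del ZT TG).
  - move=> B B' /sing[x [y [/hE -> /hE -> exy xn yn]]].
    by rewrite /= exy xn yn.
  - move=> B B1 B' B1' /sing[x [_ [BE _ _ _ _]]] /sing[x' [_ [BE' _ _ _ _]]].
    by rewrite (hE _ _ BE) (hE _ _ BE') => xx'; apply: val_inj; rewrite BE BE' xx'.
have sP (x : {x | x \in ~: O}) : [set val x] \in contraction_vertices e.
  apply/blockP; right; exists (val x) => //.
  by have := valP x; rewrite inE.
pose h (x : {x | x \in ~: O}) : W :=
  exist (fun B => B \in contraction_vertices e) [set val x] (sP x).
apply: (matching_number_hom (h := h)).
- by move=> x y; rewrite /induced /= eS.1.
- move=> x y exy; rewrite /T /contraction; apply/andP; split.
    apply/negP => /eqP/(congr1 val) /= /set1_inj xy.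
    by move: exy; rewrite /induced /= xy eS.2.
  apply/existsP; exists (val x); rewrite inE eqxx /=.
  by apply/existsP; exists (val y); rewrite inE eqxx.
- by move=> x y u v _ _ /(congr1 val) /= /set1_inj/val_inj.
Qed.

(** The graph is a disjoint union of cycles and isolated vertices, and each cycle of Type C
    contributes at least floor(q/2) + 1 to the inertia. *)
Lemma inertia_ge_typeC e : gain_graph phi e -> disjoint_cycles e ->
    subrel e (nonbridge e) -> (forall s, is_cycle e s -> typeC phi s) ->
  (matching_number e + cyc e <= inertia phi e)%N.
Proof.
have [k] := ubnP #|edges e|; elim: k e => // k IHk e lek eG de eO eC.
have eS := eG.1.
case: (boolP [exists x, exists y, e x y]) => [|no]; last first.
  have e0 x y : ~~ e x y.
    by apply: contra no => exy; apply/existsP; exists x; apply/existsP; exists y.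
  have cE : cyc e = 0%N.
    rewrite (_ : cyc e = cyc (fun _ _ : 'I_n => false)).
      by rewrite /cyc edges_rel0 n_comp_rel0 cards0 subnn.
    by apply: eq_cyc => x y; apply/negbTE.
  have : (matching_number e <= #|@set0 'I_n|)%N.
    by apply: matching_number_hit => x y; rewrite (negbTE (e0 x y)).
  by rewrite cards0 cE addn0 leqn0 => /eqP ->.
case/existsP => x /existsP[y exy].
have [s [cs xs eO' cE]] := peel_cycle eS de eO exy.
set S := [set z in s] in eO' cE; have eG' := gain_graph_del S eG.
have /is_cycleP[_ us _] := cs.
have cS : #|S| = size s by rewrite cardsE; apply/card_uniqP.
have lek' : (#|edges (del S e)| < k)%N.
  by rewrite ltnS in lek; apply: leq_trans lek; apply: (card_edges_del eS exy); rewrite inE.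
have IH := IHk (del S e) lek' eG' (disjoint_cycles_sub (@del_sub _ S e) de) eO'
  (fun t ct => eC t (is_cycle_sub (@del_sub _ S e) ct)).
pose f u v := [&& e u v, u \in s & v \in s].
have fe : subrel f e by move=> u v /and3P[].
have fG : gain_graph phi f.
  apply: (gain_graph_sub _ fe eG); split=> [u v|u]; rewrite /f ?eS.2 // eS.1.
  by rewrite [X in _ && X]andbC.
have cf : is_cycle f s.
  have /is_cycleP[s3 _ es] := cs; apply/is_cycleP; split=> // u us'.
  by rewrite /f es // mem_next us'.
have fs u v : f u v -> [set u; v] \in cycle_edges s.
  by move=> /and3P[euv us' _]; apply: (nonbridge_cycle_edge eS de cs us'); apply: eO.
have split_e u v : e u v = f u v || del S e u v.
  rewrite /f /= !inE; case: (boolP (e u v)) => //= euv.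
  by rewrite (cycle_component_closed eS de eO cs euv); case: (v \in s).
have le1 : (inertia phi f + inertia phi (del S e) <= inertia phi e)%N.
  apply: inertia_geD => // u v w /and3P[_ us' _] /and3P[_].
  by rewrite inE us'.
have le2 := (typeC_inertia fG cf fs).1 (eC s cs).
have le3 : (matching_number e <= matching_number f + matching_number (del S e))%N.
  by apply: matching_number_leD => u v; rewrite split_e.
have le4 : (matching_number f <= #|S|./2)%N.
  by apply: matching_number_half fG.1 _ => u v /and3P[_]; rewrite !inE => -> ->.
rewrite cS in le4; move: IH le1 le2 le3 le4; rewrite cE; rlia.
Qed.

End Extremal.

(** * Vertex covers obtained from condition (c) *)

Section Cover.

Variable V : finType.
Implicit Types (e : rel V) (x y : V).

Lemma contraction_edge e (B B' : {B : {set V} | B \in contraction_vertices e}) x y :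
    simple_graph e -> disjoint_cycles e -> e x y -> ~~ nonbridge e x y ->
    x \in val B -> y \in val B' ->
  @contraction _ e B B'.
Proof.
move=> eG de exy nxy xB yB'; apply/andP; split; last first.
  by apply/existsP; exists x; rewrite xB; apply/existsP; exists y; rewrite yB'.
apply: contraNneq (nxy) => BB'; rewrite /= exy.
apply: (block_connect eG de nxy (B := val B)) => //; first exact: valP.
by rewrite BB'.
Qed.

(** The singletons off the cycles in a minimum cover of the contraction already cover G - O, so
    there are at least m(G - O) of them. By (c) this is the size of the whole cover, which therefore
    contains no cycle. *)
Lemma bridge_cover e : simple_graph e -> disjoint_cycles e ->
    matching_number (@contraction _ e)
    = matching_number (@induced _ e (~: cycle_vertices e)) ->
  exists U : {set V}, [/\ [disjoint U & cycle_vertices e],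
    #|U| = matching_number (del (cycle_vertices e) e)
    & forall x y, e x y -> ~~ nonbridge e x y -> (x \in U) || (y \in U)].
Proof.
move=> eG de; rewrite matching_number_induced ?setCK; last exact: eG.1.
set O := cycle_vertices e; set T := @contraction _ e => mT.
pose W := {B : {set V} | B \in contraction_vertices e}.
have bl (B : W) : block e (val B) by exact: valP.
have [UT [cUT UTP]] := forest_cover (simple_contraction eG) (contraction_forest eG de).
pose U := [set x | (x \notin O) && [exists B in UT, val B == [set x]]].
have blW x : exists B : W, x \in val B.
  have [B bB xB] := block_of e x.
  by exists (exist (fun B => B \in contraction_vertices e) B bB).
have nO x y : x \notin O -> ~~ nonbridge e x y.
  by apply: contraNN => nxy; have [] := nonbridge_cycle_vertices eG nxy.
have leU : (matching_number (del O e) <= #|U|)%N.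
  apply: matching_number_hit => x y /and3P[exy xO yO].
  have [B xB] := blW x; have [B' yB'] := blW y.
  have TBB : T B B' by apply: contraction_edge (nO x y xO) xB yB'.
  have BE := block_set1 (bl B) xB xO; have BE' := block_set1 (bl B') yB' yO.
  case/orP: (UTP _ _ TBB) => BU; apply/orP; [left | right]; rewrite inE ?xO ?yO /=.
    by apply/existsP; exists B; rewrite BU BE eqxx.
  by apply/existsP; exists B'; rewrite BU BE' eqxx.
have sub : [set [set x] | x in U] \subset [set val B | B in UT].
  apply/subsetP => _ /imsetP[x + ->]; rewrite inE => /andP[_ /existsP[B /andP[BU /eqP <-]]].
  exact: imset_f.
have c1 : #|[set [set x] | x in U]| = #|U| by apply: card_imset; exact: set1_inj.
have c2 : #|[set val B | B in UT]| = #|UT| by apply: card_imset; exact: val_inj.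
have le2 : (#|UT| <= #|U|)%N.
  by apply: leq_trans cUT _; rewrite -/T mT.
have /eqP UE : [set [set x] | x in U] == [set val B | B in UT].
  by rewrite eqEcard sub c1 c2.
have UTE (B : W) : B \in UT -> exists2 x, x \in U & val B = [set x].
  move=> BU; have : val B \in [set [set x] | x in U] by rewrite UE imset_f.
  by case/imsetP => x xU BE; exists x.
exists U; split.
- by apply/pred0P => x; rewrite /= inE; case: (boolP (x \in O)); rewrite ?andbF.
- apply/eqP; rewrite eqn_leq leU andbT; apply: leq_trans (_ : #|UT| <= _)%N.
    by rewrite -c1 -c2; apply: subset_leq_card.
  by rewrite -mT.
- move=> x y exy nxy; have [B xB] := blW x; have [B' yB'] := blW y.
  have TBB : T B B' by apply: contraction_edge nxy xB yB'.
  case/orP: (UTP _ _ TBB) => /UTE[z zU BE]; [move: xB | move: yB'];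
    by rewrite BE inE => /eqP ->; rewrite zU ?orbT.
Qed.

(** A maximum matching covers 2|U| vertices, at most |U| of them in U; the others form W, and each
    is matched into U because U is a cover. *)
Lemma cover_mates e (U : {set V}) : simple_graph e ->
    (forall x y, e x y -> (x \in U) || (y \in U)) -> #|U| = matching_number e ->
  exists M (W : {set V}), [/\ matching e M, [disjoint U & W], (#|U| <= #|W|)%N
    & forall w, w \in W -> exists2 u, u \in U & [set w; u] \in M].
Proof.
move=> eG eU cU; have [M [mM cM]] := matching_number_witness e.
exists M, (cover M :\: U); split=> //.
- by apply/pred0P => x; rewrite /= !inE; case: (x \in U).
- have := card_cover_matching eG mM; have := cardsID U (cover M).
  have : (#|cover M :&: U| <= #|U|)%N by apply/subset_leq_card/subsetIr.
  rewrite cM cU; lia.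
- move=> w /setDP[/coverP[E EM wE] wU].
  have /andP[/subsetP/(_ _ EM)/edgesP[x [y [exy EE]]] _] := mM.
  move: wE (EM); rewrite EE => /set2P[] wE; rewrite wE in wU *.
    by exists y => //; have := eU _ _ exy; rewrite (negbTE wU).
  rewrite setUC => yxM; exists x => //.
  by have := eU _ _ exy; rewrite (negbTE wU) orbF.
Qed.

End Cover.

(** * Sufficiency of the three conditions *)

Section Sufficiency.

Variables (C : numClosedFieldType) (n : nat) (phi : 'I_n -> 'I_n -> C).
Implicit Types (e f g : rel 'I_n) (x y z u v w : 'I_n) (A : {set 'I_n}).

Lemma hform_ker_addl (A : 'M[C]_n) (v w : 'rV[C]_n) : selfadjoint A -> v *m A = 0 ->
  hform A (v + w) = hform A w.
Proof.
move=> hA vA; rewrite /hform mulmxDl vA add0r.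
have -> : (v + w) ^t* = v ^t* + w ^t* by rewrite linearD /= map_mxD.
by rewrite mulmxDr -mulmxA -{1}hA -adj_mul vA trmx0 map_mx0 mulmx0 add0r.
Qed.

(* A kernel vector supported on W and nonzero at w is also nonzero at another
   neighbour of the mate of w; following these neighbours through bridges
   decreases [branch]. *)
Lemma inertia_ge_mates e M (U W : {set 'I_n}) : gain_graph phi e ->
    [disjoint U & W] ->
    (forall x y, e x y -> (x \in U) || (y \in U) || nonbridge e x y) ->
    [disjoint U & cycle_vertices e] -> [disjoint W & cycle_vertices e] ->
    matching e M -> (forall w, w \in W -> exists2 u, u \in U & [set w; u] \in M) ->
  (#|W| + inertia phi (nonbridge e) <= inertia phi e)%N.
Proof.
move=> eG dUW eU dUO dWO mM mate; have eS := eG.1.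
set O := cycle_vertices e in dUO dWO; set H := nonbridge e.
pose S := W :|: O.
have SU x : x \in S -> x \notin U.
  case/setUP => xx; apply/negP => xU.
    by have /pred0P/(_ x) := dUW; rewrite /= xU xx.
  by have /pred0P/(_ x) := dUO; rewrite /= xU xx.
have WO x : x \in W -> x \notin O.
  by move=> xW; apply/negP => xO; have /pred0P/(_ x) := dWO; rewrite /= xW xO.
(* An edge inside S has no end in U, so it is a nonbridge; thus W contributes only isolated
   vertices. *)
have HE : del (~: S) e =2 H.
  move=> x y; apply/and3P/idP => [[exy]|Hxy].
    rewrite !in_setC !negbK => xS yS; have := eU _ _ exy.
    by rewrite (negbTE (SU _ xS)) (negbTE (SU _ yS)).
  have [xO yO] := nonbridge_cycle_vertices eS Hxy.
  by rewrite (nonbridge_subrel Hxy) !in_setC !in_setU -/O xO yO !orbT.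
have HG : gain_graph phi H.
  by apply: (gain_graph_sub _ (@nonbridge_subrel _ e) eG); apply: simple_nonbridge.
have AHE : gain_adjacency H phi
    = coord_mx C S *m gain_adjacency e phi *m (coord_mx C S) ^t*.
  rewrite -[S]setCK -gain_adjacency_del.
  by apply/matrixP => i j; rewrite !mxE HE.
have hH := selfadjoint_gain HG.
have [V [_ [[rV VH] Vp _ _ _]]] := inertia_spaces hH.
have WH (v : 'rV[C]_n) : (v <= coord_mx C W)%MS -> v *m gain_adjacency H phi = 0.
  move=> /sub_coord_mxP vW; apply/rowP => j; rewrite !mxE big1 // => i _.
  rewrite mxE; case: ifP => [Hij|_]; last by rewrite mulr0.
  rewrite vW ?mul0r //; apply: contraL (Hij) => /WO; apply: contraNN => Hij'.
  by have [] := nonbridge_cycle_vertices eS Hij'.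
have VO (v : 'rV[C]_n) : (v <= V)%MS -> (v <= coord_mx C O)%MS.
  move=> /submx_trans/(_ VH)/submxP[D ->]; apply/sub_coord_mxP => j jO.
  rewrite mxE big1 // => i _; rewrite mxE; case: ifP => [Hij|_]; last by rewrite mulr0.
  by have [_ jO'] := nonbridge_cycle_vertices eS Hij; rewrite -/O (negbTE jO) in jO'.
have dWV : (coord_mx C W :&: V)%MS = 0.
  apply: capmx_eq0 => v vW vV; apply/eqP; apply: contraT => v0.
  by have := Vp v vV v0; rewrite /hform WH // mul0mx mxE ltxx.
pose Q := (coord_mx C W + V)%MS.
have <- : \rank Q = (#|W| + inertia phi H)%N.
  by rewrite mxrank_disjoint_sum // rank_coord_mx rV.
have QE (v : 'rV[C]_n) : (v <= Q)%MS -> exists w h : 'rV[C]_n,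
    [/\ (w <= coord_mx C W)%MS, (h <= V)%MS, v = w + h
      & hform (gain_adjacency e phi) v = hform (gain_adjacency H phi) h].
  case/sub_addsmxP => -[a b] /= ->; exists (a *m coord_mx C W), (b *m V).
  split=> //; try exact: submxMl.
  set w := a *m _; set h := b *m V.
  have wW : (w <= coord_mx C W)%MS by exact: submxMl.
  have hV : (h <= V)%MS by exact: submxMl.
  (* On vectors supported on S the form of [e] is that of [H], whose kernel contains the W-part. *)
  rewrite -[RHS](hform_ker_addl h hH (WH w wW)) AHE hform_mulmx.
  rewrite coord_mx_id //; apply/sub_coord_mxP => i; rewrite in_setU negb_or.
  case/andP=> iW iO; rewrite mxE.
  have /sub_coord_mxP -> // := wW; have /sub_coord_mxP -> // := VO h hV.
  by rewrite addr0.
have Vge (h : 'rV[C]_n) : (h <= V)%MS -> 0 <= hform (gain_adjacency H phi) h.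
  move=> hV; have [->|h0] := eqVneq h 0; last by rewrite ltW // Vp.
  by rewrite /hform !mul0mx mxE.
apply: inertia_ge_rank (selfadjoint_gain eG) _ _ => v vQ.
  by have [w [h [_ hV _ ->]]] := QE v vQ; apply: Vge.
move=> vA; have [w [h [wW hV vE hE]]] := QE v vQ.
have h0 : h = 0.
  apply/eqP; apply: contraT => /(Vp h hV).
  by rewrite -hE /hform vA mul0mx mxE ltxx.
move: wW; have -> : w = v by rewrite vE h0 addr0.
move=> {QE vQ w h hV vE hE h0} /sub_coord_mxP vW.
apply/eqP; apply: contraT => /rV0Pn[w0 vw0].
have w0W : w0 \in W by apply: contraNT vw0 => /vW ->.
have [u0 u0U wuM0] := mate _ w0W.
have Me w u : [set w; u] \in M -> e w u.
  by have /andP[/subsetP Mee _] := mM; move/Mee; rewrite mem_edges //; exact: eS.1.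
pose P (q : 'I_n * 'I_n) := [&& v 0 q.1 != 0, [set q.1; q.2] \in M & q.2 \in U].
have P0 : P (w0, u0) by rewrite /P /= vw0 wuM0 u0U.
have [[w u] /and3P[/= vw wuM uU] wmin] :=
  @arg_minnP _ (w0, u0) P (fun q => branch e q.1 q.2) P0.
have ewu := Me _ _ wuM.
have wW : w \in W by apply: contraNT vw => /vW ->.
(* The kernel equation at u has the nonzero term of w, so another neighbour of u must contribute. *)
have [i [iw vi eiu]] : exists i, [/\ i != w, v 0 i != 0 & e i u].
  case: (boolP [exists i, [&& i != w, v 0 i != 0 & e i u]]) => [/existsP[i /and3P[]]|no].
    by exists i.
  have /rowP/(_ u) := vA; rewrite !mxE (bigD1 w) //= mxE ewu big1 ?addr0 => [/eqP|i iw].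
    rewrite mulf_eq0 (negbTE vw) /= => /eqP phi0.
    have [+ _] := eG.2 _ _ ewu; rewrite phi0 normr0 => /eqP.
    by rewrite eq_sym oner_eq0.
  rewrite mxE; case: ifP => [eiu|_]; last by rewrite mulr0.
  apply/eqP; rewrite mulf_eq0; apply/orP; left; apply: contraNT no => vi.
  by apply/existsP; exists i; rewrite iw vi.
have iW : i \in W by apply: contraNT vi => /vW ->.
have [u' u'U iu'M] := mate _ iW; have eiu' := Me _ _ iu'M.
have disUW x y : x \in U -> y \in W -> x != y.
  move=> xU yW; apply/eqP => xy; have /pred0P/(_ x) := dUW.
  by rewrite /= xU xy yW.
have uu' : u != u'.
  apply: contraNneq iw => uu'; have /andP[_ /trivIsetP tM] := mM.
  case: (eqVneq [set w; u] [set i; u']) => [/eqP|neq].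
    rewrite eq_set2 => /orP[] /andP[/eqP wi] => [_|/eqP ui]; first by rewrite wi.
    by have := disUW u i uU iW; rewrite ui eqxx.
  have /pred0P/(_ u) := tM _ _ wuM iu'M neq.
  by rewrite /= set22 uu' set22.
(* The edge iu' is a bridge because i is on no cycle, and the single edge iu supplies both required
   connections. *)
have : (branch e i u' < branch e w u)%N.
  apply: (branch_lt eS eiu').
  - apply: contra (WO _ iW) => niu.
    by have [] := nonbridge_cycle_vertices eS niu.
  - apply: connect1; rewrite /= eS.1 eiu /= eq_set2 (negbTE (disUW u w uU wW)) /=.
    by rewrite (negbTE iw) andbF.
  - by rewrite eq_set2 (negbTE iw) /= eq_sym (negbTE (disUW u i uU iW)).
  - apply: connect1; rewrite /= eiu /= eq_set2 eqxx (negbTE uu') /=.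
    by rewrite eq_sym (negbTE (disUW u' i u'U iW)).
by rewrite ltnNge (wmin (i, u')) // /P /= vi iu'M u'U.
Qed.

(** With H the nonbridges, p(e) >= |W| + p(H) >= |U| + m(H) + c(e) >= m(e) + c(e); the last step
    holds because U meets every edge outside H. *)
Lemma extremal_of_conditions e : gain_graph phi e -> disjoint_cycles e ->
    (forall s, is_cycle e s -> typeC phi s) ->
    matching_number (@contraction _ e)
    = matching_number (@induced _ e (~: cycle_vertices e)) ->
  extremal phi e.
Proof.
move=> eG de eC mT; have eS := eG.1.
have [U [dUO cU eU]] := bridge_cover eS de mT.
set O := cycle_vertices e in dUO cU.
have FG := simple_del O eS.
have FU x y : del O e x y -> (x \in U) || (y \in U).
  move=> /and3P[exy xO _]; apply: eU => //; apply: contra xO => nxy.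
  by have [] := nonbridge_cycle_vertices eS nxy.
have [M [W [mM dUW cW mate]]] := cover_mates FG FU cU.
have mM' : matching e M.
  apply: (matching_sub _ _ mM) => //; have /andP[Me _] := mM.
  exact: subset_trans Me (edges_sub (@del_sub _ _ e)).
have dWO : [disjoint W & O].
  apply/pred0P => w; apply/negP => /andP[/= wW wO].
  have [u _ wuM] := mate _ wW; have /andP[/subsetP/(_ _ wuM) + _] := mM.
  by rewrite mem_edges /= ?wO ?andbF //; exact: FG.1.
have eU' x y : e x y -> (x \in U) || (y \in U) || nonbridge e x y.
  by move=> exy; case: (boolP (nonbridge e x y)) => [|/(eU _ _ exy) ->] //; rewrite orbT.
have le1 := inertia_ge_mates eG dUW eU' dUO dWO mM' mate.
have HG : gain_graph phi (nonbridge e).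
  by apply: (gain_graph_sub _ (@nonbridge_subrel _ e) eG); apply: simple_nonbridge.
have le2 : (matching_number (nonbridge e) + cyc (nonbridge e)
            <= inertia phi (nonbridge e))%N.
  apply: inertia_ge_typeC => //.
  - exact: disjoint_cycles_sub (@nonbridge_subrel _ e) de.
  - exact: nonbridge_idem.
  - by move=> s cs; apply: eC; apply: is_cycle_sub cs; apply: nonbridge_subrel.
rewrite cyc_nonbridge // in le2.
have le3 : (matching_number e <= matching_number (nonbridge e) + #|U|)%N.
  apply: leq_trans (matching_number_del U e) _; rewrite leq_add2r.
  apply: matching_number_sub => x y /and3P[exy xU yU].
  by have := eU' _ _ exy; rewrite (negbTE xU) (negbTE yU).
have le4 := inertia_le eG.
move: cW le1 le2 le3 le4; rewrite /extremal; rlia.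
Qed.

End Sufficiency.

Unset Implicit Arguments.

Theorem theorem3p9 (R : realType) (n : nat) (G : rel 'I_n)
    (phi : 'I_n -> 'I_n -> R[i]) (HG : simple_graph G)
    (Hphi : unit_gain G phi) (Hconn : connected_graph G) :
  (positive_inertia (gain_adjacency G phi))%:Z
    = (matching_number G)%:Z + cyclomatic_number G
  <->
  [/\ disjoint_cycles G,
      forall s : seq 'I_n, is_cycle G s -> typeC phi s
    & matching_number (@contraction _ G)
      = matching_number (@induced _ G (~: cycle_vertices G))].
Proof.
have GG : gain_graph phi G by split.
rewrite (cyclomatic_numberE HG) -PoszD.
split=> [[ext]|[de eC mT]].
  split; [exact: extremal_disjoint GG ext | | exact: extremal_contraction GG ext].
  by move=> s; apply: extremal_typeC GG ext.
by congr Posz; apply: (extremal_of_conditions GG).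
Qed.
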